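(* Let $H$ be a weak Hopf algebra and $B$ an algebra in $\mathsf{C}$, let $\varphi_B,\phi_B:H\otimes B\to B$ be measurings, and let $\sigma,\tau:H\otimes H\to B$ be morphisms such that $\sigma\ast u_2^{\varphi_B}=\sigma$ and $\tau\ast u_2^{\phi_B}=\tau$. Assume that $\sigma$ (with respect to $\varphi_B$) and $\tau$ (with respect to $\phi_B$) satisfy the twisted condition and the 2-cocycle condition, and suppose that $\nu$ is a preunit for $\mu_{B\otimes_{\varphi_B}^{\sigma}H}$ and $u$ is a preunit for $\mu_{B\otimes_{\phi_B}^{\tau}H}$. The following assertions are equivalent: (i) The weak crossed products $(B\otimes H,\mu_{B\otimes_{\varphi_B}^{\sigma}H})$ and $(B\otimes H,\mu_{B\otimes_{\phi_B}^{\tau}H})$ are equivalent. (ii) There exist two morphisms $h,h^{-1}:H\to B$ such that $$h^{-1}\ast h=u_1^{\varphi_B},\qquad h\ast h^{-1}\ast h=h,\qquad h^{-1}\ast h\ast h^{-1}=h^{-1},$$ $$\phi_B=\mu_B\circ(\mu_B\otimes h^{-1})\circ(h\otimes P_{\varphi_B})\circ(\delta_H\otimes B),$$ $$\tau=\mu_B\circ(B\otimes h^{-1})\circ\mu_{B\otimes_{\varphi_B}^{\sigma}H}\circ\big(((h\otimes H)\circ\delta_H)\otimes((h\otimes H)\circ\delta_H)\big),$$ $$u=((\mu_B\circ(B\otimes h^{-1}))\otimes H)\circ(B\otimes\delta_H)\circ\nu.$$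
   Context: Category. $\mathsf{C}$ is a strict symmetric monoidal category with tensor product $\otimes$, unit object $K$ and symmetry $c$, in which every idempotent splits (for $q:M\to M$ with $q\circ q=q$ there are an object $N$, the image, and $i:N\to M$, $p:M\to N$ with $q=i\circ p$, $p\circ i=id_N$). For an object $M$ and a morphism $f$, $M\otimes f$ and $f\otimes M$ mean $id_M\otimes f$ and $f\otimes id_M$. Algebras $(A,\eta_A,\mu_A)$ are unital and associative, coalgebras $(D,\varepsilon_D,\delta_D)$ counital and coassociative; $\delta_{D\otimes E}=(D\otimes c_{D,E}\otimes E)\circ(\delta_D\otimes\delta_E)$. For $f,g:D\to A$ the convolution is $f\ast g=\mu_A\circ(f\otimes g)\circ\delta_D$. Weak Hopf algebra. An object $H$ with algebra structure $(\eta_H,\mu_H)$ and coalgebra structure $(\varepsilon_H,\delta_H)$ such that: (a1) $\delta_H\circ\mu_H=(\mu_H\otimes\mu_H)\circ\delta_{H\otimes H}$; (a2) $\varepsilon_H\circ\mu_H\circ(\mu_H\otimes H)=((\varepsilon_H\circ\mu_H)\otimes(\varepsilon_H\circ\mu_H))\circ(H\otimes\delta_H\otimes H)=((\varepsilon_H\circ\mu_H)\otimes(\varepsilon_H\circ\mu_H))\circ(H\otimes(c_{H,H}\circ\delta_H)\otimes H)$; (a3) $(\delta_H\otimes H)\circ\delta_H\circ\eta_H=(H\otimes\mu_H\otimes H)\circ((\delta_H\circ\eta_H)\otimes(\delta_H\circ\eta_H))=(H\otimes(\mu_H\circ c_{H,H})\otimes H)\circ((\delta_H\circ\eta_H)\otimes(\delta_H\circ\eta_H))$;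 and there is an antipode $\lambda_H:H\to H$ with (a4) $id_H\ast\lambda_H=((\varepsilon_H\circ\mu_H)\otimes H)\circ(H\otimes c_{H,H})\circ((\delta_H\circ\eta_H)\otimes H)$, (a5) $\lambda_H\ast id_H=(H\otimes(\varepsilon_H\circ\mu_H))\circ(c_{H,H}\otimes H)\circ(H\otimes(\delta_H\circ\eta_H))$, (a6) $\lambda_H\ast id_H\ast\lambda_H=\lambda_H$. Measurings. A measuring is a morphism $\varphi_B:H\otimes B\to B$ with $\varphi_B\circ(H\otimes\mu_B)=\mu_B\circ(\varphi_B\otimes\varphi_B)\circ(H\otimes c_{H,B}\otimes B)\circ(\delta_H\otimes B\otimes B)$. Put $u_1^{\varphi_B}=\varphi_B\circ(H\otimes\eta_B)$, $u_2^{\varphi_B}=\varphi_B\circ(\mu_H\otimes\eta_B)$, $P_{\varphi_B}=(\varphi_B\otimes H)\circ(H\otimes c_{H,B})\circ(\delta_H\otimes B)$ and, for $\sigma:H\otimes H\to B$, $F_\sigma=(\sigma\otimes\mu_H)\circ\delta_{H\otimes H}$. The morphism $\nabla^{\varphi_B}_{B\otimes H}=(\mu_B\otimes H)\circ(B\otimes P_{\varphi_B})\circ(B\otimes H\otimes\eta_B)$ is idempotent. Conditions on $\sigma$ (w.r.t. $\varphi_B$). Twisted condition: $\mu_B\circ(B\otimes\sigma)\circ(P_{\varphi_B}\otimes H)\circ(H\otimes P_{\varphi_B})=\mu_B\circ(B\otimes\varphi_B)\circ(F_\sigma\otimes B)$. (2-)cocycle condition: $\mu_B\circ(B\otimes\sigma)\circ(P_{\varphi_B}\otimes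 H)\circ(H\otimes F_\sigma)=\mu_B\circ(B\otimes\sigma)\circ(F_\sigma\otimes H)$. Weak crossed product. $\mu_{B\otimes_{\varphi_B}^{\sigma}H}=(\mu_B\otimes H)\circ(\mu_B\otimes F_\sigma)\circ(B\otimes P_{\varphi_B}\otimes H)$. When $\sigma\ast u_2^{\varphi_B}=\sigma$ and the twisted and cocycle conditions hold, this product is associative and $(B\otimes H,\mu_{B\otimes_{\varphi_B}^{\sigma}H})$ is called a weak crossed product. A preunit for it is a morphism $\nu:K\to B\otimes H$ with $\mu_{B\otimes_{\varphi_B}^{\sigma}H}\circ(B\otimes H\otimes\nu)=\mu_{B\otimes_{\varphi_B}^{\sigma}H}\circ(\nu\otimes B\otimes H)=\nabla^{\varphi_B}_{B\otimes H}$ and $\nu=\mu_{B\otimes_{\varphi_B}^{\sigma}H}\circ(\nu\otimes\nu)$. Let $B\times_{\varphi_B}^{\sigma}H$ be the image of $\nabla^{\varphi_B}_{B\otimes H}$, with $i^{\varphi_B}_{B\otimes H}$, $p^{\varphi_B}_{B\otimes H}$ the splitting; given a preunit $\nu$ it is an algebra with product $p^{\varphi_B}_{B\otimes H}\circ\mu_{B\otimes_{\varphi_B}^{\sigma}H}\circ(i^{\varphi_B}_{B\otimes H}\otimes i^{\varphi_B}_{B\otimes H})$ and unit $p^{\varphi_B}_{B\otimes H}\circ\nu$. Equivalence. The two weak crossed products are equivalent if there is an isomorphism $B\times_{\varphi_B}^{\sigma}H\to B\times_{\phi_B}^{\tau}H$ of algebras, left $B$-modules and right $H$-comodules, where the left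 $B$-action on $B\times_{\varphi_B}^{\sigma}H$ is $p^{\varphi_B}_{B\otimes H}\circ(\mu_B\otimes H)\circ(B\otimes i^{\varphi_B}_{B\otimes H})$ and the right $H$-coaction is $(p^{\varphi_B}_{B\otimes H}\otimes H)\circ(B\otimes\delta_H)\circ i^{\varphi_B}_{B\otimes H}$, and similarly for $(\phi_B,\tau)$. *)

(* Defs.v *)
Set Implicit Arguments.
Unset Strict Implicit.
Unset Printing Implicit Defensive.

Declare Scope smc_scope.
Delimit Scope smc_scope with smc.

Reserved Notation "f ⊗ g" (at level 35, right associativity).
Reserved Notation "A ⊠ B" (at level 35, right associativity).
Reserved Notation "g ∘ f" (at level 40, left associativity).
Reserved Notation "f ∈ A ⟶ B"
  (at level 70, A at next level, B at next level, no associativity).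

(** A strict symmetric monoidal category, given by a type of objects and a
    single type of morphisms with domain and codomain maps. In this form the
    equalities of objects [(A ⊠ B) ⊠ D = A ⊠ (B ⊠ D)], [K ⊠ A = A] and
    [A ⊠ K = A] of a strict category need no transport of morphisms.

    [comp g f] is a total function, but it is only meaningful when
    [dom g = cod f]: no law constrains it otherwise. *)
Record strictSymMonCat : Type := StrictSymMonCat {
  obj : Type;
  mor : Type;
  dom : mor -> obj;
  cod : mor -> obj;
  idm : obj -> mor;
  comp : mor -> mor -> mor;
  otens : obj -> obj -> obj;
  K : obj;
  mtens : mor -> mor -> mor;
  braid : obj -> obj -> mor;

  dom_idm : forall A, dom (idm A) = A;
  cod_idm : forall A, cod (idm A) = A;
  dom_comp : forall g f, dom g = cod f -> dom (comp g f) = dom f;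
  cod_comp : forall g f, dom g = cod f -> cod (comp g f) = cod g;
  comp_idm_l : forall f, comp (idm (cod f)) f = f;
  comp_idm_r : forall f, comp f (idm (dom f)) = f;
  comp_assoc : forall k g f, dom k = cod g -> dom g = cod f ->
    comp k (comp g f) = comp (comp k g) f;

  otensA : forall A B D, otens (otens A B) D = otens A (otens B D);
  otens1l : forall A, otens K A = A;
  otens1r : forall A, otens A K = A;
  dom_mtens : forall f g, dom (mtens f g) = otens (dom f) (dom g);
  cod_mtens : forall f g, cod (mtens f g) = otens (cod f) (cod g);
  mtens_idm : forall A B, mtens (idm A) (idm B) = idm (otens A B);
  mtens_comp : forall g f g' f', dom g = cod f -> dom g' = cod f' ->
    mtens (comp g f) (comp g' f') = comp (mtens g g') (mtens f f');
  mtensA : forall f g k, mtens (mtens f g) k = mtens f (mtens g k);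
  mtens1l : forall f, mtens (idm K) f = f;
  mtens1r : forall f, mtens f (idm K) = f;

  dom_braid : forall A B, dom (braid A B) = otens A B;
  cod_braid : forall A B, cod (braid A B) = otens B A;
  braid_nat : forall f g,
    comp (braid (cod f) (cod g)) (mtens f g) =
    comp (mtens g f) (braid (dom f) (dom g));
  braid_sym : forall A B, comp (braid B A) (braid A B) = idm (otens A B);
  braid_hexagon : forall A B D,
    braid A (otens B D) =
    comp (mtens (idm B) (braid A D)) (mtens (braid A B) (idm D))
}.

Arguments K {_}.

(** An object stands for its identity where a morphism is expected, so that
    [M ⊗ f] and [f ⊗ M] are [id_M ⊗ f] and [f ⊗ id_M]. *)
Coercion idm : obj >-> mor.

Definition hom (C : strictSymMonCat) (A B : obj C) (f : mor C) : Prop :=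
  dom f = A /\ cod f = B.

Notation "g ∘ f" := (comp g f) : smc_scope.
Notation "f ⊗ g" := (mtens f g) : smc_scope.
Notation "A ⊠ B" := (otens A B) : smc_scope.
Notation "f ∈ A ⟶ B" := (hom A B f) : smc_scope.

Open Scope smc_scope.

Definition is_splitting (C : strictSymMonCat) (M : obj C) (q : mor C)
    (N : obj C) (i p : mor C) : Prop :=
  i ∈ N ⟶ M /\ p ∈ M ⟶ N /\ q = i ∘ p /\ p ∘ i = N.

Definition idempotents_split (C : strictSymMonCat) : Prop :=
  forall (M : obj C) (q : mor C), q ∈ M ⟶ M -> q ∘ q = q ->
  exists (N : obj C) (i p : mor C), is_splitting M q N i p.

(** Convolution of [f, g : D -> A], for [delta : D -> D ⊠ D] and
    [mu : A ⊠ A -> A]. *)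
Definition conv (C : strictSymMonCat) (delta mu f g : mor C) : mor C :=
  mu ∘ (f ⊗ g) ∘ delta.

Definition tens_comul (C : strictSymMonCat) (D E : obj C)
    (deltaD deltaE : mor C) : mor C :=
  (D ⊗ braid D E ⊗ E) ∘ (deltaD ⊗ deltaE).

Record algebra (C : strictSymMonCat) : Type := Algebra {
  alg_car :> obj C;
  eta : mor C;
  mu : mor C;
  eta_hom : eta ∈ K ⟶ alg_car;
  mu_hom : mu ∈ alg_car ⊠ alg_car ⟶ alg_car;
  mu_eta_l : mu ∘ (eta ⊗ alg_car) = alg_car;
  mu_eta_r : mu ∘ (alg_car ⊗ eta) = alg_car;
  mu_assoc : mu ∘ (alg_car ⊗ mu) = mu ∘ (mu ⊗ alg_car)
}.

Record weakHopfAlgebra (C : strictSymMonCat) : Type := WeakHopfAlgebra {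
  wha_alg :> algebra C;
  eps : mor C;
  delta : mor C;
  lambda : mor C;
  eps_hom : eps ∈ wha_alg ⟶ K;
  delta_hom : delta ∈ wha_alg ⟶ wha_alg ⊠ wha_alg;
  lambda_hom : lambda ∈ wha_alg ⟶ wha_alg;
  delta_eps_l : (eps ⊗ wha_alg) ∘ delta = wha_alg;
  delta_eps_r : (wha_alg ⊗ eps) ∘ delta = wha_alg;
  delta_coassoc : (delta ⊗ wha_alg) ∘ delta = (wha_alg ⊗ delta) ∘ delta;
  wha_a1 : let H := wha_alg in
    delta ∘ mu H = (mu H ⊗ mu H) ∘ tens_comul H H delta delta;
  wha_a2 : let H := wha_alg in
    eps ∘ mu H ∘ (mu H ⊗ H) =
    ((eps ∘ mu H) ⊗ (eps ∘ mu H)) ∘ (H ⊗ delta ⊗ H);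
  wha_a2' : let H := wha_alg in
    eps ∘ mu H ∘ (mu H ⊗ H) =
    ((eps ∘ mu H) ⊗ (eps ∘ mu H)) ∘ (H ⊗ (braid H H ∘ delta) ⊗ H);
  wha_a3 : let H := wha_alg in
    (delta ⊗ H) ∘ delta ∘ eta H =
    (H ⊗ mu H ⊗ H) ∘ ((delta ∘ eta H) ⊗ (delta ∘ eta H));
  wha_a3' : let H := wha_alg in
    (delta ⊗ H) ∘ delta ∘ eta H =
    (H ⊗ (mu H ∘ braid H H) ⊗ H) ∘ ((delta ∘ eta H) ⊗ (delta ∘ eta H));
  wha_a4 : let H := wha_alg in
    conv delta (mu H) H lambda =
    ((eps ∘ mu H) ⊗ H) ∘ (H ⊗ braid H H) ∘ ((delta ∘ eta H) ⊗ H);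
  wha_a5 : let H := wha_alg in
    conv delta (mu H) lambda H =
    (H ⊗ (eps ∘ mu H)) ∘ (braid H H ⊗ H) ∘ (H ⊗ (delta ∘ eta H));
  wha_a6 : let H := wha_alg in
    conv delta (mu H) (conv delta (mu H) lambda H) lambda = lambda
}.

Section CrossedProducts.
Variables (C : strictSymMonCat) (H : weakHopfAlgebra C) (B : algebra C).

Definition deltaHH : mor C := tens_comul H H (delta H) (delta H).

Definition convH (f g : mor C) : mor C := conv (delta H) (mu B) f g.

Definition convHH (f g : mor C) : mor C := conv deltaHH (mu B) f g.

Definition measuring (phi : mor C) : Prop :=
  phi ∈ H ⊠ B ⟶ B /\
  phi ∘ (H ⊗ mu B) =
  mu B ∘ (phi ⊗ phi) ∘ (H ⊗ braid H B ⊗ B) ∘ (delta H ⊗ B ⊗ B).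

Definition u1 (phi : mor C) : mor C := phi ∘ (H ⊗ eta B).

Definition u2 (phi : mor C) : mor C := phi ∘ (mu H ⊗ eta B).

Definition P (phi : mor C) : mor C :=
  (phi ⊗ H) ∘ (H ⊗ braid H B) ∘ (delta H ⊗ B).

Definition F (sigma : mor C) : mor C := (sigma ⊗ mu H) ∘ deltaHH.

Definition nabla (phi : mor C) : mor C :=
  (mu B ⊗ H) ∘ (B ⊗ P phi) ∘ (B ⊗ H ⊗ eta B).

Definition twisted_condition (phi sigma : mor C) : Prop :=
  mu B ∘ (B ⊗ sigma) ∘ (P phi ⊗ H) ∘ (H ⊗ P phi) =
  mu B ∘ (B ⊗ phi) ∘ (F sigma ⊗ B).

Definition cocycle_condition (phi sigma : mor C) : Prop :=
  mu B ∘ (B ⊗ sigma) ∘ (P phi ⊗ H) ∘ (H ⊗ F sigma) =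
  mu B ∘ (B ⊗ sigma) ∘ (F sigma ⊗ H).

Definition wcp_mul (phi sigma : mor C) : mor C :=
  (mu B ⊗ H) ∘ (mu B ⊗ F sigma) ∘ (B ⊗ P phi ⊗ H).

Definition preunit (phi sigma nu : mor C) : Prop :=
  nu ∈ K ⟶ B ⊠ H /\
  wcp_mul phi sigma ∘ (B ⊗ H ⊗ nu) = nabla phi /\
  wcp_mul phi sigma ∘ (nu ⊗ B ⊗ H) = nabla phi /\
  nu = wcp_mul phi sigma ∘ (nu ⊗ nu).

Definition image_mul (phi sigma i p : mor C) : mor C :=
  p ∘ wcp_mul phi sigma ∘ (i ⊗ i).

Definition image_unit (nu p : mor C) : mor C := p ∘ nu.

Definition image_action (i p : mor C) : mor C := p ∘ (mu B ⊗ H) ∘ (B ⊗ i).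

Definition image_coaction (i p : mor C) : mor C :=
  (p ⊗ H) ∘ (B ⊗ delta H) ∘ i.

(** [N1], [i1], [p1] and [N2], [i2], [p2] are meant to split [nabla phi1] and
    [nabla phi2]. *)
Definition equivalent_wcp
    (phi1 sigma1 nu1 : mor C) (N1 : obj C) (i1 p1 : mor C)
    (phi2 sigma2 nu2 : mor C) (N2 : obj C) (i2 p2 : mor C) : Prop :=
  exists f : mor C,
    f ∈ N1 ⟶ N2 /\
    (exists g : mor C, g ∈ N2 ⟶ N1 /\ g ∘ f = N1 /\ f ∘ g = N2) /\
    f ∘ image_mul phi1 sigma1 i1 p1 = image_mul phi2 sigma2 i2 p2 ∘ (f ⊗ f) /\
    f ∘ image_unit nu1 p1 = image_unit nu2 p2 /\
    f ∘ image_action i1 p1 = image_action i2 p2 ∘ (B ⊗ f) /\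
    image_coaction i2 p2 ∘ f = (f ⊗ H) ∘ image_coaction i1 p1.

End CrossedProducts.

(* Main.v *)
Require Import Defs.
From Stdlib Require Import List Arith.
Import ListNotations.

(** Write [Θ t] for the endomorphism [b ⊗ h ↦ b t(h1) ⊗ h2] of [B ⊗ H] given by
    [t : H → B]. These are exactly the endomorphisms that are left [B]-linear
    and right [H]-colinear ([linear_colinear_Θ]), and they compose by
    convolution: [Θ t ∘ Θ s = Θ (s ∗ t)]. The idempotent [∇] of a measuring [φ]
    is [Θ (u1 φ)]. Hence a pair of mutually inverse linear and colinear maps
    between the two images amounts to a pair [t, t'] with [t ∗ t' = u1 φ],
    [t' ∗ t = u1 φ'], [t ∗ t' ∗ t = t] and [t' ∗ t ∗ t' = t']; in the notation of
    the theorem [t = h^-1] and [t' = h]. It remains to see when [Θ t] respects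
    products and units. The unit condition is the formula for [u] as it stands.
    Such a pair, compatible with products and units, is called a [gauge] below,
    and [equivalent_gauge] identifies gauges with equivalences.

    If [Θ t] is multiplicative, the formulas for the second measuring and the
    second cocycle follow by transporting two identities of the second crossed
    product along [Θ t']. The first is [(1 ⊗ h) (b · u) = P (h ⊗ b)], by which
    the preunit recovers the measuring from the product ([mulH_preunit]); the
    second is [(1 ⊗ h) (1 ⊗ k) = F (h ⊗ k)] ([mulH_eta]).

    Conversely, the formulas for [P] and [F] can be substituted in the product
    of [Θ t (a ⊗ h)] and [Θ t (b ⊗ k)]. Then [t] meets [t'] three times, and
    each time [t ∗ t' = u1 φ] is absorbed by the first crossed product: at [h],
    where it happens twice, because [φ] is a measuring, and at [k] because of
    the twisted condition together with [σ ∗ u2 = σ] ([mul_gauge]).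

    Two devices keep these computations short. A strictly monoidal identity is
    proved by normalizing string diagrams (the tactic [smc]). Symmetries are
    hidden in right [H]-coactions: the object [B] carries the trivial coaction
    [B ⊗ η], the object [H] carries [δ], tensor products carry the diagonal
    coaction, and all structure morphisms [P], [F], [Θ t] and the crossed
    product are colinear for these. Since a colinear morphism with target
    [B ⊗ H] is determined by its composite with [B ⊗ ε] ([cofree_eq]), an
    equation between such morphisms is checked after applying [B ⊗ ε], where it
    is, or follows from, one of the hypotheses. *)

Set Implicit Arguments.
Unset Strict Implicit.
Unset Printing Implicit Defensive.

(** * Equations of strict monoidal categories *)

Section Coherence.
Variable C : strictSymMonCat.

Inductive ob_expr : Type :=
| OUnit
| OAtom (n : nat)
| OTens (a b : ob_expr).

Inductive mor_expr : Type :=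
| MAtom (n : nat)
| MId (a : ob_expr)
| MComp (g f : mor_expr)
| MTens (f g : mor_expr).

Fixpoint word (a : ob_expr) : list nat :=
  match a with
  | OUnit => []
  | OAtom n => [n]
  | OTens a b => word a ++ word b
  end.

Definition signature := list (ob_expr * ob_expr).
Definition src (sg : signature) n := word (fst (nth n sg (OUnit, OUnit))).
Definition tgt (sg : signature) n := word (snd (nth n sg (OUnit, OUnit))).

(** The morphism [gen] with identities on both sides: every string diagram
    without crossings is a vertical stack of such layers. *)
Record layer : Type := Layer { left_ : list nat; gen : nat; right_ : list nat }.

Section Syntax.
Variable sg : signature.

Definition lsrc x := left_ x ++ src sg (gen x) ++ right_ x.
Definition ltgt x := left_ x ++ tgt sg (gen x) ++ right_ x.

(** The layers [xs], the first one applied first, form a stack from [A] to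
    [A']. *)
Fixpoint wt (A : list nat) (xs : list layer) (A' : list nat) : Prop :=
  match xs with
  | [] => A = A'
  | x :: xs => A = lsrc x /\ wt (ltgt x) xs A'
  end.

Definition word_eq := list_eq_dec Nat.eq_dec.

(** The interchange law, used in one direction only: when the wires consumed
    by [y] all lie to the left of [x], the layer [y] can be applied first. Repeated
    use of it sorts a stack. *)
Definition exchange (x y : layer) : option (layer * layer) :=
  let mid := skipn (length (left_ y) + length (src sg (gen y))) (left_ x) in
  if word_eq (left_ x) (left_ y ++ src sg (gen y) ++ mid) then
  if word_eq (right_ y) (mid ++ tgt sg (gen x) ++ right_ x) then
    Some (Layer (left_ y) (gen y) (mid ++ src sg (gen x) ++ right_ x),
          Layer (left_ y ++ tgt sg (gen y) ++ mid) (gen x) (right_ x))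
  else None else None.

Fixpoint insert (x : layer) (ys : list layer) : list layer :=
  match ys with
  | [] => [x]
  | y :: ys' =>
      match exchange x y with
      | Some (y', x') => y' :: insert x' ys'
      | None => x :: ys
      end
  end.

Fixpoint sort (xs : list layer) : list layer :=
  match xs with
  | [] => []
  | x :: xs => insert x (sort xs)
  end.

Definition whisker (L R : list nat) (x : layer) : layer :=
  Layer (L ++ left_ x) (gen x) (right_ x ++ R).

Fixpoint layers (t : mor_expr) : option (list nat * list nat * list layer) :=
  match t with
  | MAtom n => Some (src sg n, tgt sg n, [Layer [] n []])
  | MId a => Some (word a, word a, [])
  | MComp t2 t1 =>
      match layers t1, layers t2 with
      | Some (A, A', xs), Some (D, D', ys) =>
          if word_eq A' D then Some (A, D', xs ++ ys) else None
      | _, _ => None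
      end
  | MTens t1 t2 =>
      match layers t1, layers t2 with
      | Some (A, A', xs), Some (D, D', ys) =>
          Some (A ++ D, A' ++ D',
                map (whisker [] D) xs ++ map (whisker A' []) ys)
      | _, _ => None
      end
  end.

(** The words are part of the result because the stack of an identity is
    empty and does not determine its object. *)
Definition normalize (t : mor_expr) :=
  match layers t with
  | Some (A, A', xs) => Some (A, A', sort xs)
  | None => None
  end.

End Syntax.

Variable obs : list (obj C).
Variable mors : list (mor C).

Fixpoint ob_val (a : ob_expr) : obj C :=
  match a with
  | OUnit => K
  | OAtom n => nth n obs K
  | OTens a b => ob_val a ⊠ ob_val b
  end.

Fixpoint mor_val (t : mor_expr) : mor C :=
  match t with
  | MAtom n => nth n mors K
  | MId a => ob_val a
  | MComp g f => mor_val g ∘ mor_val f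
  | MTens f g => mor_val f ⊗ mor_val g
  end.

Fixpoint word_val (w : list nat) : obj C :=
  match w with
  | [] => K
  | n :: w => nth n obs K ⊠ word_val w
  end.

Lemma word_val_app v w : word_val (v ++ w) = word_val v ⊠ word_val w.
Proof.
  induction v as [|n v IH]; simpl; [now rewrite otens1l|].
  now rewrite IH, otensA.
Qed.

Lemma word_val_word a : word_val (word a) = ob_val a.
Proof.
  induction a as [|n|a IHa b IHb]; simpl; [reflexivity|apply otens1r|].
  now rewrite word_val_app, IHa, IHb.
Qed.

Lemma hom_comp (A A' D : obj C) g f :
  f ∈ A ⟶ A' -> g ∈ A' ⟶ D -> g ∘ f ∈ A ⟶ D.
Proof.
  intros [df cf] [dg cg]; split.
  - rewrite dom_comp; congruence.
  - rewrite cod_comp; congruence.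
Qed.

Lemma hom_idm (A : obj C) : A ∈ A ⟶ A.
Proof. split; [apply dom_idm | apply cod_idm]. Qed.

Lemma hom_tens (A A' D D' : obj C) f g :
  f ∈ A ⟶ A' -> g ∈ D ⟶ D' -> f ⊗ g ∈ A ⊠ D ⟶ A' ⊠ D'.
Proof.
  intros [df cf] [dg cg]; split.
  - rewrite dom_mtens; congruence.
  - rewrite cod_mtens; congruence.
Qed.

(** The axioms of a strict category speak of [dom] and [cod]; from here on
    they are used through the judgement [f ∈ A ⟶ B]. *)
Lemma comp_idl (A A' : obj C) f : f ∈ A ⟶ A' -> A' ∘ f = f.
Proof. intros [df cf]; rewrite <- cf; apply comp_idm_l. Qed.

Lemma comp_idr (A A' : obj C) f : f ∈ A ⟶ A' -> f ∘ A = f.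
Proof. intros [df cf]; rewrite <- df; apply comp_idm_r. Qed.

Lemma comp_tens (A A' A'' D D' D'' : obj C) g f g' f' :
  f ∈ A ⟶ A' -> g ∈ A' ⟶ A'' -> f' ∈ D ⟶ D' -> g' ∈ D' ⟶ D'' ->
  (g ⊗ g') ∘ (f ⊗ f') = (g ∘ f) ⊗ (g' ∘ f').
Proof.
  intros [df cf] [dg cg] [df' cf'] [dg' cg'].
  symmetry; apply mtens_comp; congruence.
Qed.

Lemma comp_assoc_hom (A A' A'' A''' : obj C) k g f :
  f ∈ A ⟶ A' -> g ∈ A' ⟶ A'' -> k ∈ A'' ⟶ A''' -> k ∘ (g ∘ f) = k ∘ g ∘ f.
Proof. intros [df cf] [dg cg] [dk ck]; apply comp_assoc; congruence. Qed.

Lemma idm_tens (A D : obj C) : idm (A ⊠ D) = A ⊗ D.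
Proof. symmetry; apply mtens_idm. Qed.

Variable sg : signature.

Definition typed_by (f : mor C) (ab : ob_expr * ob_expr) : Prop :=
  f ∈ ob_val (fst ab) ⟶ ob_val (snd ab).

Hypothesis mors_typed : Forall2 typed_by mors sg.

Definition gen_val (n : nat) : mor C := nth n mors K.

Lemma gen_val_hom n : gen_val n ∈ word_val (src sg n) ⟶ word_val (tgt sg n).
Proof.
  unfold gen_val, src, tgt.
  rewrite !word_val_word.
  revert n; induction mors_typed as [|f ab fs abs Hf Hfs IH]; intros [|n]; simpl.
  - apply hom_idm.
  - apply hom_idm.
  - exact Hf.
  - apply IH. exact Hfs.
Qed.

Definition layer_val (x : layer) : mor C :=
  word_val (left_ x) ⊗ gen_val (gen x) ⊗ word_val (right_ x).

Lemma layer_val_hom x :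
  layer_val x ∈ word_val (lsrc sg x) ⟶ word_val (ltgt sg x).
Proof.
  unfold layer_val, lsrc, ltgt; rewrite !word_val_app.
  apply hom_tens; [apply hom_idm|].
  apply hom_tens; [apply gen_val_hom|apply hom_idm].
Qed.

Fixpoint layers_val (A : list nat) (xs : list layer) : mor C :=
  match xs with
  | [] => word_val A
  | x :: xs => layers_val (ltgt sg x) xs ∘ layer_val x
  end.

Lemma layers_val_hom A xs A' :
  wt sg A xs A' -> layers_val A xs ∈ word_val A ⟶ word_val A'.
Proof.
  revert A; induction xs as [|x xs IH]; simpl; intros A.
  - intros ->; apply hom_idm.
  - intros [-> Hxs]. eapply hom_comp; [apply layer_val_hom|auto].
Qed.

Lemma wt_app A xs A' ys A'' :
  wt sg A xs A' -> wt sg A' ys A'' -> wt sg A (xs ++ ys) A''.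
Proof.
  revert A; induction xs as [|x xs IH]; simpl; intros A.
  - now intros ->.
  - intros [-> Hxs] Hys; split; auto.
Qed.

Lemma layers_val_app A xs A' ys A'' :
  wt sg A xs A' -> wt sg A' ys A'' ->
  layers_val A (xs ++ ys) = layers_val A' ys ∘ layers_val A xs.
Proof.
  intros Hxs Hys; revert A Hxs; induction xs as [|x xs IH]; simpl; intros A.
  - intros ->. symmetry; eapply comp_idr, layers_val_hom; eassumption.
  - intros [-> Hxs]. rewrite (IH _ Hxs). symmetry.
    eapply comp_assoc_hom;
      [apply layer_val_hom|eapply layers_val_hom|eapply layers_val_hom];
      eassumption.
Qed.

Lemma lsrc_whisker L R x : lsrc sg (whisker L R x) = L ++ lsrc sg x ++ R.
Proof. unfold lsrc; simpl; now rewrite !app_assoc. Qed.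

Lemma ltgt_whisker L R x : ltgt sg (whisker L R x) = L ++ ltgt sg x ++ R.
Proof. unfold ltgt; simpl; now rewrite !app_assoc. Qed.

Lemma wt_whisker L R A xs A' :
  wt sg A xs A' -> wt sg (L ++ A ++ R) (map (whisker L R) xs) (L ++ A' ++ R).
Proof.
  revert A; induction xs as [|x xs IH]; simpl; intros A.
  - now intros ->.
  - intros [-> Hxs]. rewrite lsrc_whisker, ltgt_whisker; auto.
Qed.

Lemma layers_val_whisker L R A xs A' :
  wt sg A xs A' ->
  layers_val (L ++ A ++ R) (map (whisker L R) xs) =
  word_val L ⊗ layers_val A xs ⊗ word_val R.
Proof.
  revert A; induction xs as [|x xs IH]; simpl; intros A.
  - intros ->. now rewrite !word_val_app, !idm_tens.
  - intros [-> Hxs]. rewrite ltgt_whisker, (IH _ Hxs).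
    replace (layer_val (whisker L R x))
      with (word_val L ⊗ layer_val x ⊗ word_val R)
      by (unfold layer_val; simpl;
          rewrite !word_val_app, !idm_tens, !mtensA; reflexivity).
    pose proof (layer_val_hom x) as Hx.
    pose proof (layers_val_hom Hxs) as Hv.
    pose proof (hom_idm (word_val L)) as HL.
    pose proof (hom_idm (word_val R)) as HR.
    rewrite (comp_tens HL HL (hom_tens Hx HR) (hom_tens Hv HR)).
    rewrite (comp_tens Hx Hv HR HR).
    now rewrite (comp_idl HL), (comp_idl HR).
Qed.

Lemma exchange_sound x y y' x' :
  exchange sg x y = Some (y', x') ->
  lsrc sg y' = lsrc sg x /\ lsrc sg x' = ltgt sg y' /\ ltgt sg x' = ltgt sg y /\
  layer_val x' ∘ layer_val y' = layer_val y ∘ layer_val x.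
Proof.
  destruct x as [l1 g1 r1], y as [l2 g2 r2].
  unfold exchange; simpl.
  generalize (skipn (length l2 + length (src sg g2)) l1); intros mid.
  destruct (word_eq l1 (l2 ++ src sg g2 ++ mid)) as [->|]; [|discriminate].
  destruct (word_eq r2 (mid ++ tgt sg g1 ++ r1)) as [->|]; [|discriminate].
  intros [= <- <-]. unfold lsrc, ltgt, layer_val; simpl.
  repeat split; try (now rewrite !app_assoc).
  rewrite !word_val_app, !idm_tens, !mtensA.
  pose proof (hom_idm (word_val l2)) as Hl.
  pose proof (hom_idm (word_val mid)) as Hm.
  pose proof (hom_idm (word_val r1)) as Hr.
  pose proof (gen_val_hom g1) as H1.
  pose proof (gen_val_hom g2) as H2.
  pose proof (hom_idm (word_val (src sg g1))) as Hs1.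
  pose proof (hom_idm (word_val (src sg g2))) as Hs2.
  pose proof (hom_idm (word_val (tgt sg g1))) as Ht1.
  pose proof (hom_idm (word_val (tgt sg g2))) as Ht2.
  repeat (erewrite comp_tens by eauto using hom_tens).
  now rewrite (comp_idl H1), (comp_idr H1), (comp_idl H2), (comp_idr H2).
Qed.

Lemma insert_sound x ys A A' :
  A = lsrc sg x -> wt sg (ltgt sg x) ys A' ->
  wt sg A (insert sg x ys) A' /\
  layers_val A (insert sg x ys) = layers_val (ltgt sg x) ys ∘ layer_val x.
Proof.
  revert x A; induction ys as [|y ys IH]; simpl; intros x A ->.
  - now intros ->.
  - intros [Hy Hys].
    destruct (exchange sg x y) as [[y' x']|] eqn:E; [|simpl; auto].
    destruct (exchange_sound E) as (H1 & H2 & H3 & H4); simpl.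
    rewrite <- H3 in Hys. destruct (IH x' _ (eq_sym H2) Hys) as [IH1 IH2].
    split; [auto|].
    pose proof (layers_val_hom Hys) as Hv.
    pose proof (layer_val_hom x) as Hx.
    pose proof (layer_val_hom y) as Hvy.
    pose proof (layer_val_hom x') as Hx'.
    pose proof (layer_val_hom y') as Hy'.
    rewrite H2 in Hx'. rewrite <- Hy in Hvy. rewrite H3 in *.
    rewrite IH2, <- (comp_assoc_hom Hy' Hx' Hv), H4.
    now apply (comp_assoc_hom Hx Hvy Hv).
Qed.

Lemma sort_sound A xs A' :
  wt sg A xs A' -> wt sg A (sort sg xs) A' /\
  layers_val A (sort sg xs) = layers_val A xs.
Proof.
  revert A; induction xs as [|x xs IH]; simpl; intros A.
  - auto.
  - intros [-> Hxs]. destruct (IH _ Hxs) as [IH1 IH2].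
    destruct (insert_sound eq_refl IH1) as [H1 H2].
    split; [auto|]. now rewrite H2, IH2.
Qed.

Lemma layers_sound t A A' xs :
  layers sg t = Some (A, A', xs) ->
  wt sg A xs A' /\ mor_val t = layers_val A xs.
Proof.
  revert A A' xs; induction t as [n|a|t2 IH2 t1 IH1|t1 IH1 t2 IH2]; simpl.
  - intros A A' xs [= <- <- <-]; simpl. unfold lsrc, ltgt, layer_val; simpl.
    rewrite !app_nil_r. repeat split.
    rewrite mtens1l, mtens1r. symmetry; eapply comp_idl, gen_val_hom.
  - intros A A' xs [= <- <- <-]; simpl. now rewrite word_val_word.
  - intros A A' xs.
    destruct (layers sg t1) as [[[A1 A1'] xs1]|]; [|discriminate].
    destruct (layers sg t2) as [[[A2 A2'] xs2]|]; [|discriminate].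
    destruct (word_eq A1' A2) as [->|]; [|discriminate].
    intros [= <- <- <-].
    destruct (IH1 _ _ _ eq_refl) as [W1 E1], (IH2 _ _ _ eq_refl) as [W2 E2].
    split; [eapply wt_app; eassumption|].
    now rewrite E1, E2, (layers_val_app W1 W2).
  - intros A A' xs.
    destruct (layers sg t1) as [[[A1 A1'] xs1]|]; [|discriminate].
    destruct (layers sg t2) as [[[A2 A2'] xs2]|]; [|discriminate].
    intros [= <- <- <-].
    destruct (IH1 _ _ _ eq_refl) as [W1 E1], (IH2 _ _ _ eq_refl) as [W2 E2].
    pose proof (wt_whisker [] A2 W1) as W1'.
    pose proof (wt_whisker A1' [] W2) as W2'.
    pose proof (layers_val_whisker [] A2 W1) as V1.
    pose proof (layers_val_whisker A1' [] W2) as V2.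
    simpl in *. rewrite !app_nil_r in *.
    rewrite mtens1l in V1. rewrite mtens1r in V2.
    split; [eapply wt_app; eassumption|].
    rewrite E1, E2, (layers_val_app W1' W2'), V1, V2.
    pose proof (layers_val_hom W1) as H1.
    pose proof (layers_val_hom W2) as H2.
    rewrite (comp_tens H1 (hom_idm _) (hom_idm _) H2).
    now rewrite (comp_idl H1), (comp_idr H2).
Qed.

Theorem normalize_eq t t' d :
  normalize sg t = Some d -> normalize sg t' = Some d -> mor_val t = mor_val t'.
Proof.
  unfold normalize.
  destruct (layers sg t) as [[[A A'] xs]|] eqn:E; [|discriminate].
  destruct (layers sg t') as [[[D D'] ys]|] eqn:E'; [|discriminate].
  intros [= <-] [= -> -> E3].
  destruct (layers_sound E) as [W1 ->], (layers_sound E') as [W2 ->].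
  destruct (sort_sound W1) as [_ <-], (sort_sound W2) as [_ <-].
  now rewrite E3.
Qed.

Theorem layers_hom t a a' :
  (exists xs, layers sg t = Some (word a, word a', xs)) ->
  mor_val t ∈ ob_val a ⟶ ob_val a'.
Proof.
  intros [xs E]. destruct (layers_sound E) as [W ->].
  rewrite <- !word_val_word. now apply layers_val_hom.
Qed.

End Coherence.

(** The source and target of an atomic morphism are found by instance
    resolution, from the hypotheses or from the typing lemmas declared below. *)
Existing Class hom.

Ltac mem x xs :=
  lazymatch xs with
  | nil => false
  | cons ?y ?ys => match x with y => true | _ => mem x ys end
  end.

Ltac index x xs :=
  lazymatch xs with
  | cons ?y ?ys =>
      match x with
      | y => constr:(O)
      | _ => let n := index x ys in constr:(S n)
      end
  end.

Ltac add x xs :=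
  let b := mem x xs in
  match b with true => xs | false => constr:(cons x xs) end.

Ltac ob_atoms xs a :=
  lazymatch a with
  | K => xs
  | ?a ⊠ ?b => let xs := ob_atoms xs a in ob_atoms xs b
  | _ => add a xs
  end.

Ltac mor_atoms xs f :=
  lazymatch f with
  | idm _ => xs
  | ?g ∘ ?f => let xs := mor_atoms xs f in mor_atoms xs g
  | ?g ⊗ ?f => let xs := mor_atoms xs f in mor_atoms xs g
  | _ => add f xs
  end.

Ltac mor_ob_atoms xs f :=
  lazymatch f with
  | idm ?a => ob_atoms xs a
  | ?g ∘ ?f => let xs := mor_ob_atoms xs f in mor_ob_atoms xs g
  | ?g ⊗ ?f => let xs := mor_ob_atoms xs f in mor_ob_atoms xs g
  | _ => let pf := constr:(_ : hom _ _ f) in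
         lazymatch type of pf with
         | hom ?a ?b _ => let xs := ob_atoms xs a in ob_atoms xs b
         end
  end.

Ltac quote_ob os a :=
  lazymatch a with
  | K => constr:(OUnit)
  | ?a ⊠ ?b =>
      let a := quote_ob os a in let b := quote_ob os b in constr:(OTens a b)
  | _ => let n := index a os in constr:(OAtom n)
  end.

Ltac quote_mor os ms f :=
  lazymatch f with
  | idm ?a => let a := quote_ob os a in constr:(MId a)
  | ?g ∘ ?f =>
      let g := quote_mor os ms g in let f := quote_mor os ms f in
      constr:(MComp g f)
  | ?g ⊗ ?f =>
      let g := quote_mor os ms g in let f := quote_mor os ms f in
      constr:(MTens g f)
  | _ => let n := index f ms in constr:(MAtom n)
  end.

Ltac quote_sig os ms :=
  lazymatch ms with
  | nil => constr:(@nil (ob_expr * ob_expr))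
  | cons ?f ?ms =>
      let pf := constr:(_ : hom _ _ f) in
      lazymatch type of pf with
      | hom ?a ?b _ =>
          let a := quote_ob os a in let b := quote_ob os b in
          let sg := quote_sig os ms in
          constr:(cons (a, b) sg)
      end
  end.

Ltac typed_mors :=
  repeat (apply Forall2_cons; [unfold typed_by; cbn [fst snd ob_val nth]; apply _|]);
  apply Forall2_nil.

(** [smc] proves equations and typing judgements that hold in every strict
    monoidal category. Any morphism which is not syntactically an identity, a
    composite or a tensor product is an atom; in particular symmetries are
    atoms, and the laws of symmetries, algebras and coalgebras are always
    applied by hand, between two calls of [smc]. *)
Ltac smc :=
  lazymatch goal with
  | |- @eq (mor ?C) ?f ?g =>
      let ms := mor_atoms (@nil (mor C)) f in
      let ms := mor_atoms ms g in
      let os := mor_ob_atoms (@nil (obj C)) f in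
      let os := mor_ob_atoms os g in
      let sg := quote_sig os ms in
      let t := quote_mor os ms f in
      let t' := quote_mor os ms g in
      change (mor_val os ms t = mor_val os ms t');
      eapply (@normalize_eq C os ms sg);
        [typed_mors | vm_compute; reflexivity | vm_compute; reflexivity]
  | |- @hom ?C ?a ?b ?f =>
      let ms := mor_atoms (@nil (mor C)) f in
      let os := mor_ob_atoms (@nil (obj C)) f in
      let os := ob_atoms os a in
      let os := ob_atoms os b in
      let sg := quote_sig os ms in
      let t := quote_mor os ms f in
      let a := quote_ob os a in
      let b := quote_ob os b in
      change (hom (ob_val os a) (ob_val os b) (mor_val os ms t));
      apply (@layers_hom C os ms sg);
        [typed_mors | eexists; vm_compute; reflexivity]
  end.

#[local] Existing Instances eta_hom mu_hom delta_hom eps_hom.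

(** * Symmetries *)

Section Braid.
Variable C : strictSymMonCat.

#[local] Instance braid_hom (X Y : obj C) : braid X Y ∈ X ⊠ Y ⟶ Y ⊠ X.
Proof. split; [apply dom_braid|apply cod_braid]. Qed.

Lemma braid_natural (X X' Y Y' : obj C) f g :
  f ∈ X ⟶ X' -> g ∈ Y ⟶ Y' -> braid X' Y' ∘ (f ⊗ g) = (g ⊗ f) ∘ braid X Y.
Proof. intros [<- <-] [<- <-]; apply braid_nat. Qed.

(** The hexagon for [X ⊠ K ⊠ K] makes [braid X K] idempotent, and it is
    invertible. *)
Lemma braid_unit_r (X : obj C) : braid X K = X.
Proof.
  assert (E : braid X K ∘ braid X K = braid X K).
  { pose proof (braid_hexagon X K K) as E.
    rewrite otens1l, mtens1l, mtens1r in E. now symmetry. }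
  transitivity (braid K X ∘ braid X K ∘ braid X K).
  - rewrite braid_sym. symmetry. smc.
  - transitivity (braid K X ∘ (braid X K ∘ braid X K)); [smc|].
    rewrite E, braid_sym. now rewrite otens1r.
Qed.

Lemma braid_unit_l (X : obj C) : braid K X = X.
Proof.
  transitivity (braid K X ∘ braid X K).
  - rewrite braid_unit_r. smc.
  - now rewrite braid_sym, otens1r.
Qed.

Lemma braid_tens_l (X Y Z : obj C) :
  braid (X ⊠ Y) Z = (braid X Z ⊗ Y) ∘ (X ⊗ braid Y Z).
Proof.
  transitivity ((braid X Z ⊗ Y) ∘ (X ⊗ braid Y Z) ∘
                (braid Z (X ⊠ Y) ∘ braid (X ⊠ Y) Z)).
  2: { rewrite braid_sym. smc. }
  rewrite braid_hexagon.
  transitivity ((braid X Z ⊗ Y) ∘ (X ⊗ (braid Y Z ∘ braid Z Y)) ∘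
                (braid Z X ⊗ Y) ∘ braid (X ⊠ Y) Z); [|smc].
  rewrite braid_sym.
  transitivity (((braid X Z ∘ braid Z X) ⊗ Y) ∘ braid (X ⊠ Y) Z); [|smc].
  rewrite braid_sym. smc.
Qed.

End Braid.
#[local] Existing Instance braid_hom.

(** * Coactions of a weak Hopf algebra *)

(** [rho] need be neither coassociative nor counital: when [H] is weak,
    [X ⊗ η] is in general not coassociative and diagonal coactions are not
    counital, while colinearity makes sense for any [rho]. Keeping the typing
    of [rho] outside the record lets associativity of the tensor product be an
    equality of records. *)
Record comod (C : strictSymMonCat) : Type := Comod {
  car :> obj C;
  rho : mor C
}.

Section Coactions.
Variables (C : strictSymMonCat) (H : weakHopfAlgebra C).

Definition coaction (X : comod C) : Prop := rho X ∈ X ⟶ X ⊠ H.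

Definition triv (X : obj C) : comod C := Comod X (X ⊗ eta H).
Definition reg : comod C := Comod H (delta H).
Definition ctens (X Y : comod C) : comod C :=
  Comod (X ⊠ Y) ((X ⊗ Y ⊗ mu H) ∘ (X ⊗ braid H Y ⊗ H) ∘ (rho X ⊗ rho Y)).
Notation "X ⊙ Y" := (ctens X Y) (at level 35, right associativity).

Lemma triv_coaction (X : obj C) : coaction (triv X).
Proof. unfold coaction; simpl. smc. Qed.

Lemma reg_coaction : coaction reg.
Proof. apply delta_hom. Qed.

Lemma tens_coaction X Y : coaction X -> coaction Y -> coaction (X ⊙ Y).
Proof. unfold coaction; simpl. intros HX HY. smc. Qed.
#[local] Hint Resolve triv_coaction reg_coaction tens_coaction : comodules.

Lemma tens_triv_l (X : obj C) Y :
  coaction Y -> triv X ⊙ Y = Comod (X ⊠ Y) (X ⊗ rho Y).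
Proof.
  unfold coaction, ctens; simpl; intros HY; f_equal.
  transitivity ((X ⊗ Y ⊗ mu H) ∘ (X ⊗ (braid H Y ∘ (eta H ⊗ Y)) ⊗ H)
                ∘ (X ⊗ rho Y)); [smc|].
  rewrite (braid_natural (eta_hom H) (hom_idm Y)), braid_unit_l.
  transitivity ((X ⊗ Y ⊗ (mu H ∘ (eta H ⊗ H))) ∘ (X ⊗ rho Y)); [smc|].
  rewrite mu_eta_l. smc.
Qed.

Lemma tens_triv_r X (Y : obj C) :
  coaction X ->
  X ⊙ triv Y = Comod (X ⊠ Y) ((X ⊗ braid H Y) ∘ (rho X ⊗ Y)).
Proof.
  unfold coaction, ctens; simpl; intros HX; f_equal.
  transitivity ((X ⊗ Y ⊗ (mu H ∘ (H ⊗ eta H)))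
                ∘ (X ⊗ braid H Y) ∘ (rho X ⊗ Y)); [smc|].
  rewrite mu_eta_r. smc.
Qed.

Lemma tens_unit_r X : coaction X -> X ⊙ triv K = X.
Proof.
  intros HX. rewrite (tens_triv_r K HX). unfold coaction in HX.
  destruct X as [X r]; simpl in *.
  rewrite otens1r, braid_unit_r. f_equal. smc.
Qed.

Lemma triv_tens (X Y : obj C) : triv X ⊙ triv Y = triv (X ⊠ Y).
Proof.
  rewrite (tens_triv_l X (triv_coaction Y)). unfold triv; simpl; f_equal.
  smc.
Qed.

Lemma ctensA X Y Z :
  coaction X -> coaction Y -> coaction Z -> (X ⊙ Y) ⊙ Z = X ⊙ Y ⊙ Z.
Proof.
  unfold coaction, ctens; simpl; intros HX HY HZ; f_equal; [apply otensA|].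
  rewrite braid_hexagon.
  transitivity ((X ⊗ Y ⊗ Z ⊗ mu H) ∘ (X ⊗ Y ⊗ (braid H Z ∘ (mu H ⊗ Z)) ⊗ H)
    ∘ (X ⊗ braid H Y ⊗ H ⊗ Z ⊗ H) ∘ (rho X ⊗ rho Y ⊗ rho Z)); [smc|].
  rewrite (braid_natural (mu_hom H) (hom_idm Z)), braid_tens_l.
  transitivity ((X ⊗ Y ⊗ Z ⊗ (mu H ∘ (mu H ⊗ H)))
    ∘ (X ⊗ Y ⊗ ((braid H Z ⊗ H) ∘ (H ⊗ braid H Z)) ⊗ H)
    ∘ (X ⊗ braid H Y ⊗ H ⊗ Z ⊗ H) ∘ (rho X ⊗ rho Y ⊗ rho Z)); [smc|].
  rewrite <- mu_assoc. smc.
Qed.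

Definition colinear (X Y : comod C) (f : mor C) : Prop :=
  f ∈ X ⟶ Y /\ rho Y ∘ f = (f ⊗ H) ∘ rho X.

Lemma colinear_idm X : coaction X -> colinear X X X.
Proof. intros HX; unfold coaction in HX; split; smc. Qed.

Lemma colinear_comp Y X Z g f :
  coaction X -> coaction Y -> coaction Z ->
  colinear X Y f -> colinear Y Z g -> colinear X Z (g ∘ f).
Proof.
  unfold coaction; intros HX HY HZ [Hf Ef] [Hg Eg]; split; [smc|].
  transitivity (rho Z ∘ g ∘ f); [smc|]. rewrite Eg.
  transitivity ((g ⊗ H) ∘ (rho Y ∘ f)); [smc|]. rewrite Ef. smc.
Qed.

Lemma colinear_tens X X' Y Y' f g :
  coaction X -> coaction X' -> coaction Y -> coaction Y' ->
  colinear X X' f -> colinear Y Y' g -> colinear (X ⊙ Y) (X' ⊙ Y') (f ⊗ g).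
Proof.
  unfold coaction; intros HX HX' HY HY' [Hf Ef] [Hg Eg].
  split; simpl; [smc|].
  transitivity ((X' ⊗ Y' ⊗ mu H) ∘ (X' ⊗ braid H Y' ⊗ H)
                ∘ ((rho X' ∘ f) ⊗ (rho Y' ∘ g))); [smc|].
  rewrite Ef, Eg.
  transitivity ((X' ⊗ Y' ⊗ mu H) ∘ (f ⊗ (braid H Y' ∘ (H ⊗ g)) ⊗ H)
                ∘ (rho X ⊗ rho Y)); [smc|].
  rewrite (braid_natural (hom_idm H) Hg). smc.
Qed.

Lemma colinear_triv (X Y : obj C) f : f ∈ X ⟶ Y -> colinear (triv X) (triv Y) f.
Proof. intros Hf; split; simpl; smc. Qed.

(** The trivial coaction on [Y] is essential: for two arbitrary coactions, the
    two sides multiply the coacted elements of [H] in opposite orders. *)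
Lemma colinear_braid X (Y : obj C) :
  coaction X -> colinear (X ⊙ triv Y) (triv Y ⊙ X) (braid X Y).
Proof.
  intros HX. rewrite (tens_triv_r Y HX), (tens_triv_l Y HX).
  unfold coaction in HX; split; simpl; [smc|].
  rewrite <- (braid_natural HX (hom_idm Y)), braid_tens_l. smc.
Qed.

(** Coassociativity says that [delta] is colinear when only the second copy
    of [H] in its target is coacted on. *)
Lemma colinear_delta : colinear reg (triv H ⊙ reg) (delta H).
Proof.
  rewrite (tens_triv_l H reg_coaction). split; simpl; [smc|].
  symmetry; apply delta_coassoc.
Qed.

Lemma colinear_mu : colinear (reg ⊙ reg) reg (mu H).
Proof.
  split; simpl; [smc|]. rewrite wha_a1. unfold tens_comul. smc.
Qed.

(** [V ⊗ H] is cofree on [V]: colinearity and the counit give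
    [f = (((V ⊗ eps H) ∘ f) ⊗ H) ∘ rho X]. *)
Lemma cofree_eq (V : obj C) X f g :
  coaction X ->
  colinear X (triv V ⊙ reg) f -> colinear X (triv V ⊙ reg) g ->
  (V ⊗ eps H) ∘ f = (V ⊗ eps H) ∘ g -> f = g.
Proof.
  rewrite (tens_triv_l V reg_coaction); unfold coaction; simpl.
  assert (lift : forall f, rho X ∈ X ⟶ X ⊠ H ->
    colinear X (Comod (V ⊠ H) (V ⊗ delta H)) f ->
    f = (((V ⊗ eps H) ∘ f) ⊗ H) ∘ rho X).
  { clear; simpl; intros f HX [Hf Ef]; simpl in *.
    transitivity ((V ⊗ eps H ⊗ H) ∘ ((f ⊗ H) ∘ rho X)); [|smc].
    rewrite <- Ef.
    transitivity ((V ⊗ ((eps H ⊗ H) ∘ delta H)) ∘ f); [|smc].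
    rewrite delta_eps_l. smc. }
  intros HX Hf Hg E. rewrite (lift f), (lift g), E; auto.
Qed.

End Coactions.

#[local] Hint Resolve triv_coaction reg_coaction tens_coaction : comodules.
#[local] Hint Resolve colinear_triv colinear_delta colinear_mu mu_hom eta_hom
  : comodules.
#[local] Hint Extern 1 (colinear _ _ _ (idm _)) =>
  apply colinear_idm : comodules.
#[local] Hint Extern 2 (colinear _ (ctens _ _ _) (ctens _ _ _) (_ ⊗ _)) =>
  apply colinear_tens : comodules.
#[local] Hint Extern 1 (colinear _ _ _ (braid _ _)) =>
  apply colinear_braid : comodules.

(** * Left linear and colinear morphisms into B ⊗ H *)

Section LeftLinear.
Variables (C : strictSymMonCat) (H : weakHopfAlgebra C) (B : algebra C).
Notation "X ⊙ Y" := (ctens H X Y) (at level 35, right associativity).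
Notation BH := (triv H B ⊙ reg H).

(** The left [B]-linear extension of [g : X → B ⊗ H] to [B ⊗ X]. *)
Definition ext (g : mor C) : mor C := (mu B ⊗ H) ∘ (B ⊗ g).

#[local] Instance ext_hom (X : obj C) g :
  g ∈ X ⟶ B ⊠ H -> ext g ∈ B ⊠ X ⟶ B ⊠ H.
Proof. intros Hg; unfold ext; smc. Qed.

Lemma ext_eta (X : obj C) g : g ∈ X ⟶ B ⊠ H -> ext g ∘ (eta B ⊗ X) = g.
Proof.
  intros Hg; unfold ext.
  transitivity (((mu B ∘ (eta B ⊗ B)) ⊗ H) ∘ g); [smc|].
  rewrite mu_eta_l. smc.
Qed.

Lemma ext_mu (X : obj C) g :
  g ∈ X ⟶ B ⊠ H -> ext g ∘ (mu B ⊗ X) = (mu B ⊗ H) ∘ (B ⊗ ext g).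
Proof.
  intros Hg; unfold ext.
  transitivity (((mu B ∘ (mu B ⊗ B)) ⊗ H) ∘ (B ⊗ B ⊗ g)); [smc|].
  rewrite <- mu_assoc. smc.
Qed.

Lemma ext_comp (X Y : obj C) g k :
  g ∈ X ⟶ B ⊠ H -> k ∈ Y ⟶ X -> ext (g ∘ k) = ext g ∘ (B ⊗ k).
Proof. intros Hg Hk; unfold ext. smc. Qed.

(** [ext g ∘ (f ⊗ Y)] composes [f] and [g] as morphisms with a factor [B] in
    the target, that is in the Kleisli category of the monad [B ⊗ -]; [ext] is
    functorial on it. *)
Lemma ext_ext_tens (X Y : obj C) g f :
  g ∈ H ⊠ Y ⟶ B ⊠ H -> f ∈ X ⟶ B ⊠ H ->
  ext (ext g ∘ (f ⊗ Y)) = ext g ∘ (ext f ⊗ Y).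
Proof.
  intros Hg Hf.
  transitivity ((mu B ⊗ H) ∘ (B ⊗ ext g) ∘ (B ⊗ f ⊗ Y)); [unfold ext; smc|].
  rewrite <- (ext_mu Hg). unfold ext; smc.
Qed.

Lemma ext_ext (X : obj C) g f :
  g ∈ H ⟶ B ⊠ H -> f ∈ X ⟶ B ⊠ H -> ext (ext g ∘ f) = ext g ∘ ext f.
Proof.
  intros Hg Hf.
  transitivity ((mu B ⊗ H) ∘ (B ⊗ ext g) ∘ (B ⊗ f)); [unfold ext; smc|].
  rewrite <- (ext_mu Hg). unfold ext; smc.
Qed.

Lemma linear_ext T :
  T ∈ B ⊠ H ⟶ B ⊠ H -> T ∘ (mu B ⊗ H) = (mu B ⊗ H) ∘ (B ⊗ T) ->
  T = ext (T ∘ (eta B ⊗ H)).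
Proof.
  intros HT E.
  transitivity (T ∘ ((mu B ∘ (B ⊗ eta B)) ⊗ H)); [rewrite mu_eta_r; smc|].
  transitivity (T ∘ (mu B ⊗ H) ∘ (B ⊗ eta B ⊗ H)); [smc|].
  rewrite E. unfold ext; smc.
Qed.

Lemma colinear_ext X g :
  coaction H X -> colinear H X BH g -> colinear H (triv H B ⊙ X) BH (ext g).
Proof.
  intros HX Hg.
  apply colinear_comp with (triv H (B ⊠ B) ⊙ reg H); auto with comodules.
  rewrite <- triv_tens, ctensA by auto with comodules.
  auto with comodules.
Qed.

Lemma eps_ext (X : obj C) g :
  g ∈ X ⟶ B ⊠ H -> (B ⊗ eps H) ∘ ext g = mu B ∘ (B ⊗ ((B ⊗ eps H) ∘ g)).
Proof. intros Hg; unfold ext; smc. Qed.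

(** The colinear morphism [h ↦ t(h1) ⊗ h2] with counital part [t]. *)
Definition colift (t : mor C) : mor C := (t ⊗ H) ∘ delta H.

#[local] Instance colift_hom t : t ∈ H ⟶ B -> colift t ∈ H ⟶ B ⊠ H.
Proof. intros Ht; unfold colift; smc. Qed.

Lemma colift_colinear t : t ∈ H ⟶ B -> colinear H (reg H) BH (colift t).
Proof.
  intros Ht. unfold colift.
  apply colinear_comp with (triv H H ⊙ reg H); auto with comodules.
Qed.

Lemma eps_colift t : t ∈ H ⟶ B -> (B ⊗ eps H) ∘ colift t = t.
Proof.
  intros Ht. unfold colift.
  transitivity (t ∘ ((H ⊗ eps H) ∘ delta H)); [smc|].
  rewrite delta_eps_r. smc.
Qed.

Notation Θ t := (ext (colift t)).

Lemma Θ_hom t : t ∈ H ⟶ B -> Θ t ∈ B ⊠ H ⟶ B ⊠ H.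
Proof. intros Ht; apply ext_hom, colift_hom, Ht. Qed.
#[local] Existing Instance Θ_hom.

Lemma eps_Θ t : t ∈ H ⟶ B -> (B ⊗ eps H) ∘ Θ t = mu B ∘ (B ⊗ t).
Proof. intros Ht. now rewrite (eps_ext (colift_hom Ht)), eps_colift. Qed.

Lemma Θ_linear t : t ∈ H ⟶ B -> Θ t ∘ (mu B ⊗ H) = (mu B ⊗ H) ∘ (B ⊗ Θ t).
Proof. intros Ht. apply ext_mu, colift_hom, Ht. Qed.

Lemma Θ_colinear t :
  t ∈ H ⟶ B -> (B ⊗ delta H) ∘ Θ t = (Θ t ⊗ H) ∘ (B ⊗ delta H).
Proof.
  intros Ht.
  pose proof (colinear_ext (reg_coaction H) (colift_colinear Ht)) as [_ E].
  rewrite (tens_triv_l B (reg_coaction H)) in E. exact E.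
Qed.

Lemma linear_colinear_Θ T :
  T ∈ B ⊠ H ⟶ B ⊠ H ->
  T ∘ (mu B ⊗ H) = (mu B ⊗ H) ∘ (B ⊗ T) ->
  (B ⊗ delta H) ∘ T = (T ⊗ H) ∘ (B ⊗ delta H) ->
  exists t, t ∈ H ⟶ B /\ T = Θ t.
Proof.
  intros HT Elin Ecol.
  assert (Ht : (B ⊗ eps H) ∘ T ∘ (eta B ⊗ H) ∈ H ⟶ B) by smc.
  exists ((B ⊗ eps H) ∘ T ∘ (eta B ⊗ H)); split; [exact Ht|].
  rewrite (linear_ext HT Elin) at 1. f_equal.
  unfold colift.
  transitivity ((B ⊗ eps H ⊗ H) ∘ ((T ⊗ H) ∘ (B ⊗ delta H)) ∘ (eta B ⊗ H));
    [|smc].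
  rewrite <- Ecol.
  transitivity ((B ⊗ ((eps H ⊗ H) ∘ delta H)) ∘ T ∘ (eta B ⊗ H)); [|smc].
  rewrite delta_eps_l. smc.
Qed.

Lemma Θ_inj s t : s ∈ H ⟶ B -> t ∈ H ⟶ B -> Θ s = Θ t -> s = t.
Proof.
  intros Hs Ht E.
  rewrite <- (eps_colift Hs), <- (eps_colift Ht).
  rewrite <- (ext_eta (colift_hom Hs)), <- (ext_eta (colift_hom Ht)).
  now rewrite E.
Qed.

#[local] Instance convH_hom s t :
  s ∈ H ⟶ B -> t ∈ H ⟶ B -> convH H B s t ∈ H ⟶ B.
Proof. intros Hs Ht; unfold convH, conv; smc. Qed.

Lemma convH_colift s t : s ∈ H ⟶ B -> t ∈ H ⟶ B ->
  convH H B s t = mu B ∘ (B ⊗ t) ∘ colift s.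
Proof. intros Hs Ht; unfold convH, conv, colift. smc. Qed.

Lemma Θ_colift s t : s ∈ H ⟶ B -> t ∈ H ⟶ B ->
  Θ t ∘ colift s = colift (convH H B s t).
Proof.
  intros Hs Ht; unfold ext, colift, convH, conv.
  transitivity ((mu B ⊗ H) ∘ (s ⊗ t ⊗ H) ∘ ((H ⊗ delta H) ∘ delta H)); [smc|].
  rewrite <- delta_coassoc. smc.
Qed.

Lemma Θ_Θ s t : s ∈ H ⟶ B -> t ∈ H ⟶ B -> Θ t ∘ Θ s = Θ (convH H B s t).
Proof.
  intros Hs Ht.
  now rewrite <- (ext_ext (colift_hom Ht) (colift_hom Hs)), Θ_colift.
Qed.

Lemma convH_assoc r s t : r ∈ H ⟶ B -> s ∈ H ⟶ B -> t ∈ H ⟶ B ->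
  convH H B (convH H B r s) t = convH H B r (convH H B s t).
Proof.
  intros Hr Hs Ht. apply Θ_inj; auto with typeclass_instances.
  rewrite <- !Θ_Θ by auto with typeclass_instances. smc.
Qed.

(** If [f] is colinear and its counital part is that of [Θ t ∘ g], then
    [f = Θ t ∘ g], since [Θ t] is colinear as well. *)
Lemma colinear_eq_Θ X t f g :
  coaction H X -> t ∈ H ⟶ B -> colinear H X BH f -> colinear H X BH g ->
  (B ⊗ eps H) ∘ f = mu B ∘ (B ⊗ t) ∘ g <-> f = Θ t ∘ g.
Proof.
  intros HX Ht Hf Hg.
  pose proof (proj1 Hg) as Hg1; simpl in Hg1.
  rewrite <- (eps_Θ Ht).
  split; [intros E|intros ->; smc].
  apply (cofree_eq HX Hf).
  - apply colinear_comp with BH; auto with comodules.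
    apply colinear_ext; auto with comodules. now apply colift_colinear.
  - rewrite E. smc.
Qed.

End LeftLinear.

#[local] Existing Instances ext_hom colift_hom Θ_hom convH_hom.
#[local] Hint Resolve colift_colinear colinear_ext : comodules.

(** * Measurings *)

Section CrossedProduct.
Variables (C : strictSymMonCat) (H : weakHopfAlgebra C) (B : algebra C).
Notation "X ⊙ Y" := (ctens H X Y) (at level 35, right associativity).
Notation BH := (triv H B ⊙ reg H).
Notation ext := (ext H B).
Notation colift := (colift H).
Notation Θ t := (ext (colift t)).

Section Measuring.
Variable phi : mor C.
Hypothesis phi_meas : measuring H B phi.
Let phi_hom : phi ∈ H ⊠ B ⟶ B := proj1 phi_meas.
#[local] Existing Instance phi_hom.
Notation P := (P H B phi).
Notation u1 := (u1 H B phi).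

#[local] Instance P_hom : P ∈ H ⊠ B ⟶ B ⊠ H.
Proof. unfold P; smc. Qed.

Lemma P_colinear : colinear H (reg H ⊙ triv H B) BH P.
Proof.
  unfold P.
  apply colinear_comp with (triv H H ⊙ reg H ⊙ triv H B); auto with comodules.
  - rewrite <- ctensA by auto with comodules. auto with comodules.
  - apply colinear_comp with (triv H H ⊙ triv H B ⊙ reg H); auto with comodules.
    rewrite <- ctensA, triv_tens by auto with comodules.
    auto with comodules.
Qed.

Lemma eps_P : (B ⊗ eps H) ∘ P = phi.
Proof.
  unfold P.
  transitivity (phi ∘ (H ⊗ ((B ⊗ eps H) ∘ braid H B)) ∘ (delta H ⊗ B)); [smc|].
  rewrite <- (braid_natural (eps_hom H) (hom_idm B)), braid_unit_l.
  transitivity (phi ∘ (((H ⊗ eps H) ∘ delta H) ⊗ B)); [smc|].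
  rewrite delta_eps_r. smc.
Qed.

#[local] Instance u1_hom : u1 ∈ H ⟶ B.
Proof. unfold u1; smc. Qed.

Lemma P_eta : P ∘ (H ⊗ eta B) = colift u1.
Proof.
  apply (cofree_eq (reg_coaction H) (V := B)).
  - apply colinear_comp with (reg H ⊙ triv H B); auto with comodules.
    + rewrite <- (tens_unit_r (reg_coaction H)) at 1. auto with comodules.
    + apply P_colinear.
  - apply colift_colinear, u1_hom.
  - rewrite (eps_colift u1_hom).
    transitivity ((B ⊗ eps H) ∘ P ∘ (H ⊗ eta B)); [smc|].
    now rewrite eps_P.
Qed.

Lemma nabla_Θ : nabla H B phi = Θ u1.
Proof. rewrite <- P_eta. unfold nabla, ext. smc. Qed.

(** The counital part of this equation is the definition of a measuring. *)
Lemma P_mu : P ∘ (H ⊗ mu B) = ext P ∘ (P ⊗ B).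
Proof.
  apply (@cofree_eq C H B (reg H ⊙ triv H B ⊙ triv H B)); auto with comodules.
  - apply colinear_comp with (reg H ⊙ triv H B); auto with comodules.
    + rewrite triv_tens. auto with comodules.
    + apply P_colinear.
  - apply colinear_comp with (triv H B ⊙ reg H ⊙ triv H B); auto with comodules.
    + rewrite <- !ctensA by auto with comodules.
      apply colinear_tens; auto with comodules. apply P_colinear.
    + apply colinear_ext; auto with comodules. apply P_colinear.
  - transitivity ((B ⊗ eps H) ∘ P ∘ (H ⊗ mu B)); [smc|].
    transitivity ((B ⊗ eps H) ∘ ext P ∘ (P ⊗ B)); [|smc].
    rewrite (eps_ext P_hom), eps_P, (proj2 phi_meas). unfold P. smc.
Qed.

Lemma ext_P_u1 : ext P ∘ (colift u1 ⊗ B) = P.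
Proof.
  rewrite <- P_eta.
  transitivity (ext P ∘ (P ⊗ B) ∘ (H ⊗ eta B ⊗ B)); [smc|].
  rewrite <- P_mu.
  transitivity (P ∘ (H ⊗ (mu B ∘ (eta B ⊗ B)))); [smc|].
  rewrite mu_eta_l; smc.
Qed.

Lemma Θ_u1_P : Θ u1 ∘ P = P.
Proof.
  rewrite <- P_eta, (ext_comp P_hom (X := H ⊠ B) (Y := H)) by smc.
  transitivity (ext P ∘ (P ⊗ B) ∘ (H ⊗ B ⊗ eta B)); [smc|].
  rewrite <- P_mu.
  transitivity (P ∘ (H ⊗ (mu B ∘ (B ⊗ eta B)))); [smc|].
  rewrite mu_eta_r; smc.
Qed.

End Measuring.

(** * The product of a weak crossed product *)

Record twisted_datum (phi sigma : mor C) : Prop := TwistedDatum {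
  datum_measuring : measuring H B phi;
  datum_hom : sigma ∈ H ⊠ H ⟶ B;
  datum_u2 : convHH H B sigma (u2 H B phi) = sigma;
  datum_twisted : twisted_condition H B phi sigma
}.

Section Product.
Variables phi sigma : mor C.
Hypothesis D : twisted_datum phi sigma.
Let phi_hom : phi ∈ H ⊠ B ⟶ B := proj1 (datum_measuring D).
Let sigma_hom : sigma ∈ H ⊠ H ⟶ B := datum_hom D.
Let meas := datum_measuring D.
Let Pphi_hom := P_hom meas.
Let u1phi_hom := u1_hom meas.
#[local] Existing Instances phi_hom sigma_hom Pphi_hom u1phi_hom.
Notation P := (P H B phi).
Notation u1 := (u1 H B phi).
Notation F := (F H sigma).

#[local] Instance F_hom : F ∈ H ⊠ H ⟶ B ⊠ H.
Proof. unfold F, deltaHH, tens_comul; smc. Qed.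

Lemma F_colinear : colinear H (reg H ⊙ reg H) BH F.
Proof.
  unfold F, deltaHH, tens_comul.
  apply colinear_comp with ((triv H (H ⊠ H)) ⊙ reg H ⊙ reg H);
    auto with comodules.
  apply colinear_comp with (triv H H ⊙ reg H ⊙ triv H H ⊙ reg H);
    auto 6 with comodules.
  - rewrite <- ctensA by auto with comodules. auto with comodules.
  - rewrite <- triv_tens, !ctensA by auto with comodules.
    apply colinear_tens; auto 6 with comodules.
    rewrite <- !ctensA by auto with comodules. auto with comodules.
Qed.

Lemma sigma_F_u1 : mu B ∘ (B ⊗ u1) ∘ F = sigma.
Proof.
  rewrite <- (datum_u2 D) at 2.
  unfold convHH, conv, F, u1, u2, deltaHH, tens_comul. smc.
Qed.

Lemma Θ_u1_F : Θ u1 ∘ F = F.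
Proof.
  destruct F_colinear as [_ E].
  rewrite (tens_triv_l B (reg_coaction H)) in E; simpl in E.
  unfold ext, colift.
  transitivity (((mu B ∘ (B ⊗ u1)) ⊗ H) ∘ ((B ⊗ delta H) ∘ F)); [smc|].
  rewrite E.
  transitivity (((mu B ∘ (B ⊗ u1) ∘ F) ⊗ mu H) ∘ deltaHH H).
  - unfold deltaHH, tens_comul. smc.
  - now rewrite sigma_F_u1.
Qed.

(** The counit of a weak Hopf algebra is not multiplicative, so this is not
    immediate from the definition of [F]: it uses [Θ_u1_F], hence
    [sigma ∗ u2 = sigma]. *)
Lemma eps_F : (B ⊗ eps H) ∘ F = sigma.
Proof.
  rewrite <- Θ_u1_F.
  transitivity ((B ⊗ eps H) ∘ Θ u1 ∘ F); [smc|].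
  rewrite (eps_Θ u1phi_hom). apply sigma_F_u1.
Qed.

(** The product of [1 ⊗ h] and [b ⊗ k]; being left [B]-linear, the product is
    the extension of this restriction. *)
Definition mulH : mor C := ext F ∘ (P ⊗ H).

#[local] Instance mulH_hom : mulH ∈ H ⊠ B ⊠ H ⟶ B ⊠ H.
Proof. unfold mulH; smc. Qed.

Lemma mulH_colinear : colinear H (reg H ⊙ BH) BH mulH.
Proof.
  unfold mulH.
  apply colinear_comp with (triv H B ⊙ reg H ⊙ reg H); auto with comodules.
  - rewrite <- !ctensA by auto with comodules.
    apply colinear_tens; auto with comodules. apply P_colinear, meas.
  - apply colinear_ext; auto with comodules. apply F_colinear.
Qed.

Lemma wcp_mul_ext : wcp_mul H B phi sigma = ext mulH.
Proof.
  unfold wcp_mul, mulH, ext.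
  transitivity (((mu B ∘ (mu B ⊗ B)) ⊗ H) ∘ (B ⊗ B ⊗ F)
                ∘ (B ⊗ P ⊗ H)); [smc|].
  rewrite <- mu_assoc. smc.
Qed.

Lemma mulH_mu : mulH ∘ (H ⊗ mu B ⊗ H) = ext mulH ∘ (P ⊗ B ⊗ H).
Proof.
  unfold mulH.
  rewrite (ext_ext_tens F_hom Pphi_hom).
  transitivity (ext F ∘ ((ext P ∘ (P ⊗ B)) ⊗ H)); [|smc].
  rewrite <- (P_mu meas); smc.
Qed.

Lemma mulH_u1_l : ext mulH ∘ (colift u1 ⊗ B ⊠ H) = mulH.
Proof.
  transitivity (ext (ext F ∘ (P ⊗ H)) ∘ (colift u1 ⊗ B ⊗ H));
    [unfold mulH; smc|].
  rewrite (ext_ext_tens F_hom Pphi_hom).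
  transitivity (ext F ∘ ((ext P ∘ (colift u1 ⊗ B)) ⊗ H)); [smc|].
  now rewrite (ext_P_u1 meas).
Qed.

(** The counital part of this equation is the twisted condition at the unit of
    [B], once [sigma ∗ u2 = sigma] has simplified its right-hand side. *)
Lemma mulH_u1_F : mulH ∘ (H ⊗ colift u1) = F.
Proof.
  apply (@cofree_eq C H B (reg H ⊙ reg H)); auto with comodules.
  - apply colinear_comp with (reg H ⊙ BH); auto 6 with comodules.
    apply mulH_colinear.
  - apply F_colinear.
  - pose proof (datum_twisted D) as twisted; unfold twisted_condition in twisted.
    rewrite eps_F, <- (P_eta meas).
    transitivity ((B ⊗ eps H) ∘ ext F ∘ (P ⊗ H) ∘ (H ⊗ P) ∘ (H ⊗ H ⊗ eta B));
      [unfold mulH; smc|].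
    rewrite (eps_ext F_hom), eps_F, twisted.
    transitivity (mu B ∘ (B ⊗ u1) ∘ F); [unfold u1; smc|].
    apply sigma_F_u1.
Qed.

Lemma mulH_u1_r : mulH ∘ (H ⊗ Θ u1) = mulH.
Proof.
  transitivity (mulH ∘ (H ⊗ mu B ⊗ H) ∘ (H ⊗ B ⊗ colift u1));
    [unfold ext; smc|].
  rewrite mulH_mu.
  transitivity (ext mulH ∘ (B ⊗ H ⊗ colift u1) ∘ (P ⊗ H)); [smc|].
  rewrite <- (ext_comp mulH_hom (Y := H ⊠ H)) by smc.
  now rewrite mulH_u1_F.
Qed.

Lemma mulH_eta : mulH ∘ (H ⊗ eta B ⊗ H) = F.
Proof.
  transitivity (ext F ∘ ((P ∘ (H ⊗ eta B)) ⊗ H)); [unfold mulH; smc|].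
  rewrite (P_eta meas), <- mulH_u1_F at 1.
  rewrite (ext_comp mulH_hom (Y := H ⊠ H)) by smc.
  transitivity (ext mulH ∘ (colift u1 ⊗ B ⊠ H) ∘ (H ⊗ colift u1)); [smc|].
  now rewrite mulH_u1_l, mulH_u1_F.
Qed.

Lemma Θ_u1_mul : Θ u1 ∘ ext mulH = ext mulH.
Proof.
  rewrite <- (ext_ext (colift_hom u1phi_hom) mulH_hom). unfold mulH at 1.
  transitivity (ext (Θ u1 ∘ ext F ∘ (P ⊗ H))); [f_equal; smc|].
  now rewrite <- (ext_ext (colift_hom u1phi_hom) F_hom), Θ_u1_F.
Qed.

Lemma mul_Θ_u1 : ext mulH ∘ (Θ u1 ⊗ Θ u1) = ext mulH.
Proof.
  transitivity (ext mulH ∘ (Θ u1 ⊗ B ⊠ H) ∘ (B ⊗ H ⊗ Θ u1)); [smc|].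
  rewrite <- (ext_ext_tens (Y := B ⊠ H) mulH_hom (colift_hom u1phi_hom)).
  rewrite mulH_u1_l.
  transitivity (ext (mulH ∘ (H ⊗ Θ u1))).
  - symmetry. apply (ext_comp (Y := H ⊠ B ⊠ H) mulH_hom). smc.
  - now rewrite mulH_u1_r.
Qed.

(** In the crossed product [(1 ⊗ h) (b · nu) = φ(h1 ⊗ b) · ((1 ⊗ h2) nu)],
    and multiplying by the preunit on the right is [∇]. *)
Lemma mulH_preunit nu : preunit H B phi sigma nu ->
  mulH ∘ (H ⊗ ((mu B ⊗ H) ∘ (B ⊗ nu))) = P.
Proof.
  intros (Hnu & E & _).
  rewrite wcp_mul_ext, (nabla_Θ meas) in E.
  assert (E' : mulH ∘ (H ⊗ nu) = colift u1).
  { rewrite <- (ext_eta mulH_hom).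
    transitivity (ext mulH ∘ (B ⊗ H ⊗ nu) ∘ (eta B ⊗ H)); [smc|].
    rewrite E. apply ext_eta, colift_hom, u1phi_hom. }
  transitivity (mulH ∘ (H ⊗ mu B ⊗ H) ∘ (H ⊗ B ⊗ nu)); [smc|].
  rewrite mulH_mu.
  transitivity (ext mulH ∘ (B ⊗ H ⊗ nu) ∘ P); [smc|].
  transitivity (ext (mulH ∘ (H ⊗ nu)) ∘ P); [unfold ext; smc|].
  rewrite E'. apply (Θ_u1_P meas).
Qed.

Lemma preunit_Θ_u1 nu : preunit H B phi sigma nu -> Θ u1 ∘ nu = nu.
Proof.
  intros (Hnu & _ & _ & E).
  rewrite wcp_mul_ext in E. rewrite E at 1.
  transitivity (Θ u1 ∘ ext mulH ∘ (nu ⊗ nu)); [smc|].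
  now rewrite Θ_u1_mul.
Qed.

End Product.
End CrossedProduct.

#[local] Existing Instances u1_hom P_hom F_hom mulH_hom.
#[local] Hint Resolve P_colinear F_colinear mulH_colinear : comodules.
(** * Gauges *)

Section Gauges.
Variables (C : strictSymMonCat) (H : weakHopfAlgebra C) (B : algebra C).
Notation ext := (ext H B).
Notation colift := (colift H).
Notation Θ t := (ext (colift t)).
Notation P := (P H B).
Notation F := (F H).
Notation u1 := (u1 H B).
Notation mulH := (mulH H B).
Infix "∗" := (convH H B) (at level 40, left associativity).

Record gauge (phi sigma nu phi' sigma' nu' t t' : mor C) : Prop := Gauge {
  gauge_hom : t ∈ H ⟶ B;
  gauge_hom' : t' ∈ H ⟶ B;
  gauge_inv : t ∗ t' = u1 phi;
  gauge_inv' : t' ∗ t = u1 phi';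
  gauge_u1 : u1 phi ∗ t = t;
  gauge_u1' : u1 phi' ∗ t' = t';
  gauge_mul : Θ t ∘ ext (mulH phi sigma) = ext (mulH phi' sigma') ∘ (Θ t ⊗ Θ t);
  gauge_unit : Θ t ∘ nu = nu'
}.

Section TwoProducts.
Variables phi sigma phi' sigma' : mor C.
Hypotheses (D : twisted_datum H B phi sigma) (D' : twisted_datum H B phi' sigma').
Let meas := datum_measuring D.
Let meas' := datum_measuring D'.
Let phi_hom : phi ∈ H ⊠ B ⟶ B := proj1 meas.
Let phi_hom' : phi' ∈ H ⊠ B ⟶ B := proj1 meas'.
Let P_phi_hom := P_hom meas.
Let P_phi_hom' := P_hom meas'.
Let u1_phi_hom := u1_hom meas.
Let u1_phi_hom' := u1_hom meas'.
Let F_sigma_hom := F_hom D.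
Let F_sigma_hom' := F_hom D'.
Let mul_hom := mulH_hom D.
Let mul_hom' := mulH_hom D'.
#[local] Existing Instances phi_hom phi_hom' P_phi_hom P_phi_hom' u1_phi_hom
  u1_phi_hom' F_sigma_hom F_sigma_hom' mul_hom mul_hom'.

Lemma gauge_sym nu nu' t t' :
  preunit H B phi sigma nu ->
  gauge phi sigma nu phi' sigma' nu' t t' ->
  gauge phi' sigma' nu' phi sigma nu t' t.
Proof.
  intros Hnu [Ht Ht' I I' U U' E Eu].
  pose proof (proj1 Hnu) as Hn.
  split; auto.
  - rewrite <- (mul_Θ_u1 D'), <- I', <- (Θ_Θ Ht' Ht).
    transitivity (Θ t' ∘ (ext (mulH phi' sigma') ∘ (Θ t ⊗ Θ t)) ∘ (Θ t' ⊗ Θ t'));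
      [smc|].
    rewrite <- E.
    transitivity (Θ t' ∘ Θ t ∘ ext (mulH phi sigma) ∘ (Θ t' ⊗ Θ t')); [smc|].
    now rewrite (Θ_Θ Ht Ht'), I, (Θ_u1_mul D).
  - rewrite <- Eu.
    transitivity (Θ t' ∘ Θ t ∘ nu); [smc|].
    rewrite (Θ_Θ Ht Ht'), I. apply (preunit_Θ_u1 D Hnu).
Qed.

(** [Θ t'] turns [(1 ⊗ h) (b · nu') = P phi' (h ⊗ b)] into a product in the
    first crossed product, which [mulH_preunit] evaluates again. *)
Lemma gauge_P nu nu' t t' :
  preunit H B phi sigma nu -> preunit H B phi' sigma' nu' ->
  gauge phi sigma nu phi' sigma' nu' t t' ->
  P phi' = Θ t ∘ (ext (P phi) ∘ (colift t' ⊗ B)).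
Proof.
  intros Hnu Hnu' G.
  destruct (gauge_sym Hnu G) as [_ _ _ _ _ _ E' Eu'].
  destruct G as [Ht Ht' I I' U U' E Eu].
  pose proof (proj1 Hnu) as Hn. pose proof (proj1 Hnu') as Hn'.
  rewrite <- (Θ_u1_P meas'), <- I', <- (Θ_Θ Ht' Ht).
  rewrite <- (mulH_preunit D' Hnu'), <- (ext_eta mul_hom').
  transitivity (Θ t ∘ (Θ t' ∘ ext (mulH phi' sigma'))
    ∘ (eta B ⊗ H ⊗ ((mu B ⊗ H) ∘ (B ⊗ nu')))); [smc|].
  rewrite E'.
  transitivity (Θ t ∘ ext (mulH phi sigma)
    ∘ ((Θ t' ∘ (eta B ⊗ H)) ⊗ (Θ t' ∘ (mu B ⊗ H) ∘ (B ⊗ nu')))); [smc|].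
  rewrite (ext_eta (colift_hom Ht')), (Θ_linear Ht').
  transitivity (Θ t ∘ ext (mulH phi sigma)
    ∘ (colift t' ⊗ ((mu B ⊗ H) ∘ (B ⊗ (Θ t' ∘ nu'))))); [smc|].
  rewrite Eu', <- (mulH_preunit D Hnu).
  unfold ext; smc.
Qed.

Lemma gauge_F nu nu' t t' :
  preunit H B phi sigma nu ->
  gauge phi sigma nu phi' sigma' nu' t t' ->
  F sigma' = Θ t ∘ (ext (mulH phi sigma) ∘ (colift t' ⊗ colift t')).
Proof.
  intros Hnu G.
  destruct (gauge_sym Hnu G) as [_ _ _ _ _ _ E' _].
  destruct G as [Ht Ht' I I' U U' E Eu].
  rewrite <- (ext_eta (colift_hom Ht')).
  transitivity (Θ t ∘ (ext (mulH phi sigma) ∘ (Θ t' ⊗ Θ t'))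
                ∘ (eta B ⊗ H ⊗ eta B ⊗ H)); [|smc].
  rewrite <- E'.
  transitivity (Θ t ∘ Θ t' ∘ ext (mulH phi' sigma') ∘ (eta B ⊗ H ⊗ B ⊗ H)
                ∘ (H ⊗ eta B ⊗ H)); [|smc].
  rewrite (Θ_Θ Ht' Ht), I', (Θ_u1_mul D').
  rewrite <- (mulH_eta D'), <- (ext_eta mul_hom') at 1.
  smc.
Qed.

(** All morphisms in the equation on the right are colinear, and its counital
    part is the equation on the left. *)
Lemma P_gauge t t' : t ∈ H ⟶ B -> t' ∈ H ⟶ B ->
  phi' = mu B ∘ (mu B ⊗ t) ∘ (t' ⊗ P phi) ∘ (delta H ⊗ B) <->
  P phi' = Θ t ∘ (ext (P phi) ∘ (colift t' ⊗ B)).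
Proof.
  intros Ht Ht'.
  replace (mu B ∘ (mu B ⊗ t) ∘ (t' ⊗ P phi) ∘ (delta H ⊗ B))
    with (mu B ∘ (B ⊗ t) ∘ (ext (P phi) ∘ (colift t' ⊗ B)))
    by (unfold ext, colift; smc).
  rewrite <- (eps_P meas') at 1.
  apply (colinear_eq_Θ (X := ctens H (reg H) (triv H B))); auto with comodules.
  apply colinear_comp with (ctens H (triv H B) (ctens H (reg H) (triv H B)));
    auto with comodules.
  rewrite <- ctensA by auto with comodules. auto with comodules.
Qed.

Lemma F_gauge t t' : t ∈ H ⟶ B -> t' ∈ H ⟶ B ->
  sigma' = mu B ∘ (B ⊗ t) ∘ ext (mulH phi sigma) ∘ (colift t' ⊗ colift t') <->
  F sigma' = Θ t ∘ (ext (mulH phi sigma) ∘ (colift t' ⊗ colift t')).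
Proof.
  intros Ht Ht'.
  replace (mu B ∘ (B ⊗ t) ∘ ext (mulH phi sigma) ∘ (colift t' ⊗ colift t'))
    with (mu B ∘ (B ⊗ t) ∘ (ext (mulH phi sigma) ∘ (colift t' ⊗ colift t')))
    by smc.
  rewrite <- (eps_F D') at 1.
  apply (colinear_eq_Θ (X := ctens H (reg H) (reg H)));
    eauto using F_colinear with comodules.
  apply colinear_comp with
    (ctens H (triv H B) (ctens H (reg H) (ctens H (triv H B) (reg H))));
    auto 6 with comodules.
  rewrite <- (ctensA (X := triv H B) (Y := reg H)) by auto with comodules.
  auto with comodules.
Qed.

(** Reading the product of [Θ t (a ⊗ h)] and [Θ t (b ⊗ k)] from the left, the
    morphism [t] is followed by the [t'] of the formula for [P phi'], then the
    [t] of that formula by the [t'] of the formula for [F sigma'] at [h], and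
    finally the [t] of the second factor by its [t'] at [k]. Each meeting
    leaves a [u1 phi], and the first crossed product absorbs it. *)
Lemma mul_gauge t t' :
  t ∈ H ⟶ B -> t' ∈ H ⟶ B -> t ∗ t' = u1 phi ->
  P phi' = Θ t ∘ (ext (P phi) ∘ (colift t' ⊗ B)) ->
  F sigma' = Θ t ∘ (ext (mulH phi sigma) ∘ (colift t' ⊗ colift t')) ->
  Θ t ∘ ext (mulH phi sigma) = ext (mulH phi' sigma') ∘ (Θ t ⊗ Θ t).
Proof.
  intros Ht Ht' I EP EF.
  pose proof (colift_hom Ht) as Hc. pose proof (colift_hom Ht') as Hc'.
  assert (EP' : ext (P phi') ∘ (colift t ⊗ B) = Θ t ∘ P phi).
  { rewrite EP, (ext_ext (X := H ⊠ B) Hc) by smc.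
    rewrite (ext_ext_tens (Y := B) P_phi_hom Hc').
    transitivity (Θ t ∘ (ext (P phi) ∘ ((Θ t' ∘ colift t) ⊗ B))); [smc|].
    now rewrite (Θ_colift Ht Ht'), I, (ext_P_u1 meas). }
  assert (EF' : ext (F sigma') ∘ (colift t ⊗ H)
                = Θ t ∘ mulH phi sigma ∘ (H ⊗ colift t')).
  { rewrite EF, (ext_ext (X := H ⊠ H) Hc) by smc.
    replace (ext (mulH phi sigma) ∘ (colift t' ⊗ colift t'))
      with (ext (mulH phi sigma) ∘ (colift t' ⊗ B ⊠ H) ∘ (H ⊗ colift t')) by smc.
    rewrite (ext_comp (X := H ⊠ B ⊠ H) (Y := H ⊠ H)) by smc.
    rewrite (ext_ext_tens (Y := B ⊠ H) mul_hom Hc').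
    transitivity (Θ t ∘ (ext (mulH phi sigma) ∘ ((Θ t' ∘ colift t) ⊗ B ⊠ H))
                  ∘ (H ⊗ colift t')); [smc|].
    now rewrite (Θ_colift Ht Ht'), I, (mulH_u1_l D). }
  (* By left linearity it suffices to treat a first factor [1 ⊗ h]. *)
  assert (EM : Θ t ∘ mulH phi sigma = ext (mulH phi' sigma') ∘ (colift t ⊗ Θ t)).
  { symmetry.
    transitivity (ext (ext (F sigma') ∘ (P phi' ⊗ H))
                  ∘ (colift t ⊗ B ⊗ H) ∘ (H ⊗ Θ t)); [unfold mulH; smc|].
    rewrite (ext_ext_tens (Y := H) F_sigma_hom' P_phi_hom').
    transitivity (ext (F sigma')
      ∘ ((ext (P phi') ∘ (colift t ⊗ B)) ⊗ H) ∘ (H ⊗ Θ t)); [smc|].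
    rewrite EP'.
    transitivity (ext (F sigma') ∘ (Θ t ⊗ H) ∘ (P phi ⊗ H) ∘ (H ⊗ Θ t)); [smc|].
    rewrite <- (ext_ext_tens (Y := H) F_sigma_hom' Hc), EF'.
    transitivity (ext (Θ t ∘ mulH phi sigma) ∘ (P phi ⊗ B ⊗ H)
                  ∘ (H ⊗ B ⊗ colift t') ∘ (H ⊗ Θ t)); [unfold ext; smc|].
    rewrite (ext_ext (X := H ⊠ B ⊠ H) Hc mul_hom).
    transitivity (Θ t ∘ (ext (mulH phi sigma) ∘ (P phi ⊗ B ⊗ H))
                  ∘ (H ⊗ B ⊗ colift t') ∘ (H ⊗ Θ t)); [smc|].
    rewrite <- (mulH_mu D).
    transitivity (Θ t ∘ mulH phi sigma ∘ (H ⊗ (Θ t' ∘ Θ t))); [unfold ext; smc|].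
    rewrite (Θ_Θ Ht Ht'), I.
    transitivity (Θ t ∘ (mulH phi sigma ∘ (H ⊗ Θ (u1 phi)))); [smc|].
    now rewrite (mulH_u1_r D). }
  rewrite <- (ext_ext (X := H ⊠ B ⊠ H) Hc mul_hom), EM.
  transitivity (ext (ext (mulH phi' sigma') ∘ (colift t ⊗ B ⊠ H))
                ∘ (B ⊗ H ⊗ Θ t)); [unfold ext; smc|].
  rewrite (ext_ext_tens (Y := B ⊠ H) mul_hom' Hc). smc.
Qed.

End TwoProducts.

(** * Morphisms between the images of the idempotents *)

Lemma splitting_absorb (V : obj C) q N i p :
  is_splitting V q N i p -> p ∘ q = p /\ q ∘ i = i.
Proof.
  intros (Hi & Hp & -> & E). split.
  - transitivity (p ∘ i ∘ p); [smc|]. rewrite E; smc.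
  - transitivity (i ∘ (p ∘ i)); [smc|]. rewrite E; smc.
Qed.

(** A morphism [f] between the images corresponds to [i' ∘ f ∘ p] on [B ⊗ H];
    since the idempotents [Θ s] and [Θ s'] are linear and colinear themselves,
    the two properties pass from [f] to [i' ∘ f ∘ p]. *)
Lemma image_map_Θ s s' N i p N' i' p' f :
  s ∈ H ⟶ B -> s' ∈ H ⟶ B ->
  is_splitting (B ⊠ H) (Θ s) N i p ->
  is_splitting (B ⊠ H) (Θ s') N' i' p' ->
  f ∈ N ⟶ N' ->
  f ∘ image_action H B i p = image_action H B i' p' ∘ (B ⊗ f) ->
  image_coaction H B i' p' ∘ f = (f ⊗ H) ∘ image_coaction H B i p ->
  exists t, t ∈ H ⟶ B /\ i' ∘ f ∘ p = Θ t.
Proof.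
  intros Hs Hs' S S' Hf Fact Fcoact.
  destruct (splitting_absorb S) as [pq _].
  destruct (splitting_absorb S') as [_ qi'].
  destruct S as (Hi & Hp & Eip & _), S' as (Hi' & Hp' & Eip' & _).
  unfold image_action in Fact. unfold image_coaction in Fcoact.
  apply linear_colinear_Θ; [smc| |].
  - rewrite <- pq at 1.
    transitivity (i' ∘ f ∘ p ∘ (Θ s ∘ (mu B ⊗ H))); [smc|].
    rewrite Θ_linear, Eip by exact Hs.
    transitivity (i' ∘ (f ∘ (p ∘ (mu B ⊗ H) ∘ (B ⊗ i))) ∘ (B ⊗ p)); [smc|].
    rewrite Fact.
    transitivity ((i' ∘ p') ∘ (mu B ⊗ H) ∘ (B ⊗ (i' ∘ f ∘ p))); [smc|].
    rewrite <- Eip', Θ_linear by exact Hs'.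
    transitivity ((mu B ⊗ H) ∘ (B ⊗ ((Θ s' ∘ i') ∘ f ∘ p))); [smc|].
    now rewrite qi'.
  - rewrite <- qi' at 1.
    transitivity (((B ⊗ delta H) ∘ Θ s') ∘ i' ∘ f ∘ p); [smc|].
    rewrite (Θ_colinear Hs'), Eip'.
    transitivity ((i' ⊗ H) ∘ ((p' ⊗ H) ∘ (B ⊗ delta H) ∘ i' ∘ f) ∘ p); [smc|].
    rewrite Fcoact.
    transitivity (((i' ∘ f ∘ p) ⊗ H) ∘ ((B ⊗ delta H) ∘ (i ∘ p))); [smc|].
    rewrite <- Eip, (Θ_colinear Hs).
    transitivity (((i' ∘ f ∘ (p ∘ Θ s)) ⊗ H) ∘ (B ⊗ delta H)); [smc|].
    now rewrite pq.
Qed.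

Lemma Θ_image_map s s' N i p N' i' p' t :
  s ∈ H ⟶ B -> s' ∈ H ⟶ B ->
  is_splitting (B ⊠ H) (Θ s) N i p ->
  is_splitting (B ⊠ H) (Θ s') N' i' p' ->
  t ∈ H ⟶ B -> Θ t ∘ Θ s = Θ t -> Θ s' ∘ Θ t = Θ t ->
  let f := p' ∘ Θ t ∘ i in
  f ∘ image_action H B i p = image_action H B i' p' ∘ (B ⊗ f) /\
  image_coaction H B i' p' ∘ f = (f ⊗ H) ∘ image_coaction H B i p.
Proof.
  intros Hs Hs' (Hi & Hp & Eip & _) (Hi' & Hp' & Eip' & _) Ht Et Et' f; subst f.
  unfold image_action, image_coaction.
  split.
  - transitivity (p' ∘ (Θ t ∘ (i ∘ p)) ∘ (mu B ⊗ H) ∘ (B ⊗ i)); [smc|].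
    rewrite <- Eip, Et.
    transitivity (p' ∘ (Θ t ∘ (mu B ⊗ H)) ∘ (B ⊗ i)); [smc|].
    rewrite (Θ_linear Ht).
    transitivity (p' ∘ (mu B ⊗ H) ∘ (B ⊗ ((i' ∘ p') ∘ Θ t ∘ i))); [|smc].
    rewrite <- Eip', Et'. smc.
  - transitivity ((p' ⊗ H) ∘ (B ⊗ delta H) ∘ ((i' ∘ p') ∘ Θ t) ∘ i); [smc|].
    rewrite <- Eip', Et'.
    transitivity ((p' ⊗ H) ∘ ((B ⊗ delta H) ∘ Θ t) ∘ i); [smc|].
    rewrite (Θ_colinear Ht).
    transitivity (((p' ∘ (Θ t ∘ (i ∘ p))) ⊗ H) ∘ (B ⊗ delta H) ∘ i); [|smc].
    rewrite <- Eip, Et. smc.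
Qed.

Lemma image_map_inverse N i p N' i' p' f g :
  i ∈ N ⟶ B ⊠ H -> p ∈ B ⊠ H ⟶ N -> i' ∈ N' ⟶ B ⊠ H -> p' ∈ B ⊠ H ⟶ N' ->
  f ∈ N ⟶ N' -> g ∈ N' ⟶ N -> g ∘ f = N -> f ∘ g = N' ->
  f ∘ image_action H B i p = image_action H B i' p' ∘ (B ⊗ f) ->
  image_coaction H B i' p' ∘ f = (f ⊗ H) ∘ image_coaction H B i p ->
  g ∘ image_action H B i' p' = image_action H B i p ∘ (B ⊗ g) /\
  image_coaction H B i p ∘ g = (g ⊗ H) ∘ image_coaction H B i' p'.
Proof.
  unfold image_action, image_coaction.
  intros Hi Hp Hi' Hp' Hf Hg Egf Efg Fact Fcoact. split.
  - transitivity (g ∘ (p' ∘ (mu B ⊗ H) ∘ (B ⊗ i') ∘ (B ⊗ f)) ∘ (B ⊗ g)).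
    + transitivity (g ∘ p' ∘ (mu B ⊗ H) ∘ (B ⊗ (i' ∘ (f ∘ g)))); [|smc].
      rewrite Efg; smc.
    + rewrite <- Fact.
      transitivity ((g ∘ f) ∘ p ∘ (mu B ⊗ H) ∘ (B ⊗ i) ∘ (B ⊗ g)); [smc|].
      rewrite Egf; smc.
  - transitivity ((g ⊗ H) ∘ ((f ⊗ H) ∘ ((p ⊗ H) ∘ (B ⊗ delta H) ∘ i)) ∘ g).
    + transitivity ((((g ∘ f) ∘ p) ⊗ H) ∘ (B ⊗ delta H) ∘ i ∘ g); [|smc].
      rewrite Egf; smc.
    + rewrite <- Fcoact.
      transitivity (((g ∘ p') ⊗ H) ∘ (B ⊗ delta H) ∘ i' ∘ (f ∘ g)); [smc|].
      rewrite Efg; smc.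
Qed.

(** An isomorphism [f] and its inverse [g] correspond to the pair with
    [Θ t = i' ∘ f ∘ p] and [Θ t' = i ∘ g ∘ p'], and conversely
    [f = p' ∘ Θ t ∘ i]. *)
Lemma equivalent_gauge phi sigma nu phi' sigma' nu' N i p N' i' p' :
  twisted_datum H B phi sigma -> twisted_datum H B phi' sigma' ->
  preunit H B phi sigma nu -> preunit H B phi' sigma' nu' ->
  is_splitting (B ⊠ H) (nabla H B phi) N i p ->
  is_splitting (B ⊠ H) (nabla H B phi') N' i' p' ->
  equivalent_wcp H B phi sigma nu N i p phi' sigma' nu' N' i' p' <->
  exists t t', gauge phi sigma nu phi' sigma' nu' t t'.
Proof.
  intros D D' Pn Pn' S S'.
  rewrite (nabla_Θ (datum_measuring D)) in S.
  rewrite (nabla_Θ (datum_measuring D')) in S'.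
  destruct (splitting_absorb S) as [pq _].
  destruct (splitting_absorb S') as [pq' _].
  pose proof (mulH_hom D) as HM. pose proof (mulH_hom D') as HM'.
  pose proof (u1_hom (datum_measuring D)) as Hu.
  pose proof (u1_hom (datum_measuring D')) as Hu'.
  pose proof (proj1 Pn) as Hn. pose proof (proj1 Pn') as Hn'.
  pose proof S as (Hi & Hp & Eip & Epi).
  pose proof S' as (Hi' & Hp' & Eip' & Epi').
  unfold equivalent_wcp, image_mul, image_unit.
  rewrite (wcp_mul_ext D), (wcp_mul_ext D').
  split.
  - intros (f & Hf & (g & Hg & Egf & Efg) & Fmul & Funit & Fact & Fcoact).
    destruct (image_map_inverse Hi Hp Hi' Hp' Hf Hg Egf Efg Fact Fcoact)
      as [Gact Gcoact].
    destruct (image_map_Θ Hu Hu' S S' Hf Fact Fcoact) as (t & Ht & ET).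
    destruct (image_map_Θ Hu' Hu S' S Hg Gact Gcoact) as (t' & Ht' & ET').
    exists t, t'; split; try assumption.
    + apply (@Θ_inj C H B); auto with typeclass_instances.
      rewrite <- (Θ_Θ Ht Ht'), <- ET, <- ET', Eip.
      transitivity (i ∘ (g ∘ (p' ∘ i') ∘ f) ∘ p); [smc|].
      rewrite Epi'. transitivity (i ∘ (g ∘ f) ∘ p); [smc|]. rewrite Egf; smc.
    + apply (@Θ_inj C H B); auto with typeclass_instances.
      rewrite <- (Θ_Θ Ht' Ht), <- ET, <- ET', Eip'.
      transitivity (i' ∘ (f ∘ (p ∘ i) ∘ g) ∘ p'); [smc|].
      rewrite Epi. transitivity (i' ∘ (f ∘ g) ∘ p'); [smc|]. rewrite Efg; smc.
    + apply (@Θ_inj C H B); auto with typeclass_instances.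
      rewrite <- (Θ_Θ Hu Ht), <- ET.
      transitivity (i' ∘ f ∘ (p ∘ Θ (u1 phi))); [smc|]. now rewrite pq.
    + apply (@Θ_inj C H B); auto with typeclass_instances.
      rewrite <- (Θ_Θ Hu' Ht'), <- ET'.
      transitivity (i ∘ g ∘ (p' ∘ Θ (u1 phi'))); [smc|]. now rewrite pq'.
    + rewrite <- (mul_Θ_u1 D), <- ET, Eip.
      transitivity (i' ∘ (f ∘ (p ∘ ext (mulH phi sigma) ∘ (i ⊗ i))) ∘ (p ⊗ p));
        [smc|].
      rewrite Fmul.
      transitivity ((i' ∘ p') ∘ ext (mulH phi' sigma')
        ∘ ((i' ∘ f ∘ p) ⊗ (i' ∘ f ∘ p))); [smc|].
      now rewrite <- Eip', (Θ_u1_mul D').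
    + rewrite <- ET, <- (preunit_Θ_u1 D' Pn'), Eip'.
      transitivity (i' ∘ (f ∘ (p ∘ nu))); [smc|]. rewrite Funit. smc.
  - intros (t & t' & [Ht Ht' I I' U U' E Eu]).
    assert (Et : Θ t ∘ Θ (u1 phi) = Θ t) by now rewrite Θ_Θ, U.
    assert (Et' : Θ (u1 phi') ∘ Θ t = Θ t).
    { rewrite <- I', <- (Θ_Θ Ht' Ht).
      transitivity (Θ t ∘ (Θ t' ∘ Θ t)); [smc|]. now rewrite (Θ_Θ Ht Ht'), I. }
    exists (p' ∘ Θ t ∘ i).
    destruct (Θ_image_map Hu Hu' S S' Ht Et Et') as [Fact Fcoact].
    split; [smc|]. split; [|split; [|split; [|split; assumption]]].
    + exists (p ∘ Θ t' ∘ i'). split; [smc|split].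
      * transitivity (p ∘ Θ t' ∘ ((i' ∘ p') ∘ Θ t) ∘ i); [smc|].
        rewrite <- Eip', Et'.
        transitivity (p ∘ (Θ t' ∘ Θ t) ∘ i); [smc|].
        rewrite (Θ_Θ Ht Ht'), I, pq. exact Epi.
      * transitivity (p' ∘ (Θ t ∘ (i ∘ p)) ∘ Θ t' ∘ i'); [smc|].
        rewrite <- Eip, Et.
        transitivity (p' ∘ (Θ t ∘ Θ t') ∘ i'); [smc|].
        rewrite (Θ_Θ Ht' Ht), I', pq'. exact Epi'.
    + transitivity (p' ∘ (Θ t ∘ (i ∘ p)) ∘ ext (mulH phi sigma) ∘ (i ⊗ i)); [smc|].
      rewrite <- Eip, Et.
      transitivity (p' ∘ (Θ t ∘ ext (mulH phi sigma)) ∘ (i ⊗ i)); [smc|].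
      rewrite E.
      transitivity (p' ∘ ext (mulH phi' sigma')
        ∘ (((i' ∘ p') ∘ Θ t ∘ i) ⊗ ((i' ∘ p') ∘ Θ t ∘ i))); [|smc].
      rewrite <- Eip', Et'. smc.
    + transitivity (p' ∘ (Θ t ∘ (i ∘ p)) ∘ nu); [smc|].
      rewrite <- Eip, Et, <- Eu. smc.
Qed.

(** At the unit of [B] the formula for [phi'] reads
    [u1 phi' = t' ∗ u1 phi ∗ t], and [u1 phi = t ∗ t']. *)
Lemma gauge_formula_inv' phi phi' t t' :
  measuring H B phi -> t ∈ H ⟶ B -> t' ∈ H ⟶ B ->
  t ∗ t' = u1 phi -> t' ∗ t ∗ t' = t' ->
  phi' = mu B ∘ (mu B ⊗ t) ∘ (t' ⊗ P phi) ∘ (delta H ⊗ B) ->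
  t' ∗ t = u1 phi'.
Proof.
  intros meas Ht Ht' I U' ->.
  pose proof (proj1 meas) as Hphi. pose proof (P_hom meas) as HP.
  pose proof (u1_hom meas) as Hu.
  symmetry; unfold u1 at 1.
  transitivity (mu B ∘ (B ⊗ t) ∘ (ext (P phi ∘ (H ⊗ eta B)) ∘ colift t'));
    [unfold ext, colift; smc|].
  rewrite (P_eta meas), (Θ_colift Ht' Hu).
  rewrite <- (convH_colift (convH_hom Ht' Hu) Ht).
  now rewrite <- I, <- (convH_assoc Ht' Ht Ht'), U'.
Qed.

End Gauges.

Unset Implicit Arguments.

Theorem theorem2p4
    (C : strictSymMonCat) (splitC : idempotents_split C)
    (H : weakHopfAlgebra C) (B : algebra C)
    (varphi phi sigma tau nu u : mor C)
    (varphi_meas : measuring H B varphi)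
    (phi_meas : measuring H B phi)
    (sigma_hom : sigma ∈ H ⊠ H ⟶ B)
    (tau_hom : tau ∈ H ⊠ H ⟶ B)
    (sigma_u2 : convHH H B sigma (u2 H B varphi) = sigma)
    (tau_u2 : convHH H B tau (u2 H B phi) = tau)
    (sigma_twisted : twisted_condition H B varphi sigma)
    (tau_twisted : twisted_condition H B phi tau)
    (sigma_cocycle : cocycle_condition H B varphi sigma)
    (tau_cocycle : cocycle_condition H B phi tau)
    (nu_preunit : preunit H B varphi sigma nu)
    (u_preunit : preunit H B phi tau u)
    (N : obj C) (i p : mor C)
    (split_varphi : is_splitting (B ⊠ H) (nabla H B varphi) N i p)
    (N' : obj C) (i' p' : mor C)
    (split_phi : is_splitting (B ⊠ H) (nabla H B phi) N' i' p') :
  equivalent_wcp H B varphi sigma nu N i p phi tau u N' i' p' <->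
  exists h hinv : mor C,
    h ∈ H ⟶ B /\
    hinv ∈ H ⟶ B /\
    convH H B hinv h = u1 H B varphi /\
    convH H B (convH H B h hinv) h = h /\
    convH H B (convH H B hinv h) hinv = hinv /\
    phi = mu B ∘ (mu B ⊗ hinv) ∘ (h ⊗ P H B varphi) ∘ (delta H ⊗ B) /\
    tau = mu B ∘ (B ⊗ hinv) ∘ wcp_mul H B varphi sigma
            ∘ (((h ⊗ H) ∘ delta H) ⊗ ((h ⊗ H) ∘ delta H)) /\
    u = ((mu B ∘ (B ⊗ hinv)) ⊗ H) ∘ (B ⊗ delta H) ∘ nu.
Proof.
  assert (D : twisted_datum H B varphi sigma) by now split.
  assert (D' : twisted_datum H B phi tau) by now split.
  pose proof (proj1 nu_preunit) as Hn.
  rewrite (equivalent_gauge D D' nu_preunit u_preunit split_varphi split_phi).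
  rewrite (wcp_mul_ext D).
  split.
  - intros (t & t' & G).
    pose proof (gauge_P D D' nu_preunit u_preunit G) as EP.
    pose proof (gauge_F D D' nu_preunit G) as EF.
    destruct G as [Ht Ht' I I' U U' _ Eu].
    exists t', t.
    split; [exact Ht'|]. split; [exact Ht|]. split; [exact I|].
    rewrite I, I'. split; [exact U'|]. split; [exact U|].
    split; [exact (proj2 (P_gauge D D' Ht Ht') EP)|].
    split; [exact (proj2 (F_gauge D D' Ht Ht') EF)|].
    rewrite <- Eu. unfold ext, colift. smc.
  - intros (h & hinv & Hh & Hinv & I & Uh & Uinv & Ephi & Etau & Eu).
    exists hinv, h.
    pose proof (gauge_formula_inv' varphi_meas Hinv Hh I Uh Ephi) as I'.
    split; auto.
    + now rewrite <- I.
    + now rewrite <- I'.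
    + apply (mul_gauge D D' Hinv Hh I).
      * exact (proj1 (P_gauge D D' Hinv Hh) Ephi).
      * exact (proj1 (F_gauge D D' Hinv Hh) Etau).
    + rewrite Eu. unfold ext, colift. smc.
Qed.
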